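(* Let $G$ be a finite $3$-regular $(X,Y)$-bigraph. Then $G$ has a path $X$-cover consisting of at most $\alpha_{\mathsf{\Lambda}}(G)$ paths.
   Context: An $(X,Y)$-bigraph is a bipartite graph together with a specified ordered bipartition $(X,Y)$ of its vertex set. A path $X$-cover of $G$ is a set of pairwise vertex-disjoint paths in $G$ (paths of length $0$ allowed) whose union contains every vertex of $X$. For $S \subseteq X$, let ${\mathsf{\Lambda}}(S)$ denote the set of vertices of $Y$ that have at least two neighbors in $S$. A set $S \subseteq X$ is ${\mathsf{\Lambda}}$-independent if ${\mathsf{\Lambda}}(S) = \varnothing$, i.e. no two vertices of $S$ have a common neighbor. The ${\mathsf{\Lambda}}$-independence number $\alpha_{\mathsf{\Lambda}}(G)$ is the maximum size of a ${\mathsf{\Lambda}}$-independent subset of $X$. *)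

(* Defs.v *)
From mathcomp Require Import all_boot.

Set Implicit Arguments.
Unset Strict Implicit.
Unset Printing Implicit Defensive.

(* A finite simple graph is an adjacency relation [e] on a finite type. *)

Definition bigraph (V : finType) (e : rel V) (X Y : {set V}) : Prop :=
  [/\ symmetric e, irreflexive e, X :|: Y = [set: V], [disjoint X & Y]
    & forall u v, e u v ->
        (u \in X) && (v \in Y) || (u \in Y) && (v \in X)].

Definition nbr (V : finType) (e : rel V) (v : V) : {set V} :=
  [set u | e v u].

Definition regular (V : finType) (e : rel V) (k : nat) : Prop :=
  forall v, #|nbr e v| = k.

(* A path is given by its nonempty vertex sequence; [:: x] has length 0. *)
Definition gpath (V : finType) (e : rel V) (p : seq V) : bool :=
  if p is x :: s then path e x s && uniq (x :: s) else false.

(* The paths of a cover are nonempty and pairwise vertex-disjoint, hence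
   distinct, even up to reversal; so [size P] is the number of paths. *)
Definition path_cover (V : finType) (e : rel V) (X : {set V})
    (P : seq (seq V)) : Prop :=
  [/\ all (gpath e) P,
      pairwise (fun p q : seq V => [disjoint p & q]) P
    & forall x, x \in X -> exists2 p, p \in P & x \in p].

Definition Lambda (V : finType) (e : rel V) (Y S : {set V}) : {set V} :=
  [set y in Y | 2 <= #|nbr e y :&: S|].

Definition Lambda_independent (V : finType) (e : rel V) (X Y S : {set V})
    : bool :=
  (S \subset X) && (Lambda e Y S == set0).

Definition alpha_Lambda (V : finType) (e : rel V) (X Y : {set V}) : nat :=
  \max_(S : {set V} | Lambda_independent e X Y S) #|S|.

(* Main.v *)
(* Cover X by vertex-disjoint cycles and paths with both ends in X, choosing
   first the number p of members minimal, then the number q of paths minimal,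
   then the sum of the squared path sizes maximal. Opening the cycles gives a
   path X-cover, so a Λ-independent set of size p is enough. Exactly q vertices
   u of Y are unused, and minimality forbids many configurations around them:
   two ends cannot share an unused u, an end has no neighbour on a cycle, and so
   on. If the first vertex s of a path can be linked (through a used or an unused
   vertex of Y) to a vertex next to x so that x becomes an end of a new minimal
   cover, we say that s labels x; labelled vertices inherit the restrictions on
   ends, and two labels issued by different heads are nearly always incompatible.
   Each head s whose unused neighbour u leads deep into another path is replaced
   by such a neighbour x of u, and each cycle with at most one neighbour on the
   paths contributes a vertex all of whose neighbours lie on that cycle; the k
   vertices chosen in this way conflict with nothing else. The other heads, one
   vertex per remaining unused u, and the path vertices adjacent to the other
   cycles form a set of at least 2(p - k) elements. Ordered by decreasing path
   size and then by position, each of them has a common neighbour with at most one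
   earlier element, so half of them are Λ-independent. *)

Require Import Defs.
From mathcomp Require Import all_boot.
From mathcomp Require Import zify.
From Stdlib Require Import Classical.

Set Implicit Arguments.
Unset Strict Implicit.
Unset Printing Implicit Defensive.

Section PathCovers.

Context (V : finType) (e : rel V) (X : {set V}).
Context (e_sym : symmetric e).
Context (eX : forall u v, e u v -> (u \in X) = (v \notin X)).

Implicit Types (x y z a b s u : V) (p q L R P Q : seq V) (Ps Cs : seq (seq V)).

(** * Ends of vertex sequences *)

Definition beg x p := ohead p == Some x.
Definition fin x p := ohead (rev p) == Some x.

Lemma begP x p : beg x p -> exists q, p = x :: q.
Proof. by case: p => [|a q] //= /eqP [->]; exists q. Qed.

Lemma finP x p : fin x p -> exists q, p = rcons q x.
Proof.
by case/lastP: p => [|q a] //; rewrite /fin rev_rcons => /eqP [->]; exists q.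
Qed.

Lemma beg_rev x p : beg x (rev p) = fin x p. Proof. by []. Qed.
Lemma fin_rev x p : fin x (rev p) = beg x p.
Proof. by rewrite /fin revK. Qed.

Lemma beg_cons x p : beg x (x :: p). Proof. by rewrite /beg /=. Qed.
Lemma fin_rcons x p : fin x (rcons p x).
Proof. by rewrite -beg_rev rev_rcons beg_cons. Qed.
Lemma beg_cat x p q : beg x p -> beg x (p ++ q).
Proof. by case/begP => r ->; rewrite beg_cons. Qed.
Lemma fin_cat x p q : fin x q -> fin x (p ++ q).
Proof. by case/finP => r ->; rewrite -rcons_cat fin_rcons. Qed.
Lemma fin_cons x y q : fin x q -> fin x (y :: q).
Proof. exact: (@fin_cat _ [:: y]). Qed.
Lemma beg_catl a z p q : fin a p -> beg z (p ++ q) -> beg z p.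
Proof. by case: p. Qed.
Lemma fin_catr b z p q : beg b q -> fin z (p ++ q) -> fin z q.
Proof. by rewrite -!beg_rev rev_cat -fin_rev; exact: beg_catl. Qed.
Lemma fin_consr b z y q : beg b q -> fin z (y :: q) -> fin z q.
Proof. exact: (@fin_catr b z [:: y]). Qed.
Lemma beg_mem x p : beg x p -> x \in p.
Proof. by case/begP => r ->; rewrite inE eqxx. Qed.
Lemma fin_mem x p : fin x p -> x \in p.
Proof. by rewrite -beg_rev => /beg_mem; rewrite mem_rev. Qed.
Lemma beg_inj x y p : beg x p -> beg y p -> x = y.
Proof. by rewrite /beg /fin => /eqP -> /eqP []. Qed.
Lemma fin_inj x y p : fin x p -> fin y p -> x = y.
Proof. by rewrite /beg /fin => /eqP -> /eqP []. Qed.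

(** * Paths with both ends in X, cycles, and ways to join and open them *)

Definition xpath p :=
  if p is x :: q then [&& x \in X, path e x q & last x q \in X] else false.

(** As for [xpath], distinctness of the vertices is left to [cov]; the bound on the size rules out
    an edge traversed back and forth. *)
Definition xcyc p := cycle e p && (2 < size p).

Lemma eX' u v : e u v -> (u \notin X) = (v \in X).
Proof. by move/eX => ->; rewrite negbK. Qed.

Lemma xpath_begE p : xpath p -> exists2 x, beg x p & x \in X.
Proof. by case: p => //= x q /and3P [xX _ _]; exists x; rewrite ?beg_cons. Qed.

Lemma xpath_rev p : xpath (rev p) = xpath p.
Proof.
have imp q : xpath q -> xpath (rev q).
  case: q => // x q; rewrite [xpath (x :: q)]/= => /and3P [xX pq lX].
  case/lastP: q pq lX => [|q z] pq lX; first by rewrite /= xX.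
  rewrite last_rcons in lX.
  rewrite rev_cons rev_rcons /= lX last_rcons xX andbT /=.
  have := rev_path e x (rcons q z); rewrite last_rcons belast_rcons rev_cons => ->.
  by rewrite (eq_path (e' := e)) // => ? ?; rewrite e_sym.
by apply/idP/idP => /imp; rewrite ?revK.
Qed.

Lemma xpath_finE p : xpath p -> exists2 x, fin x p & x \in X.
Proof. by rewrite -xpath_rev => /xpath_begE [x]; rewrite beg_rev; exists x. Qed.

Lemma beg_X x p : xpath p -> beg x p -> x \in X.
Proof. by case/xpath_begE => y b1 yX b2; rewrite (beg_inj b2 b1). Qed.
Lemma fin_X x p : xpath p -> fin x p -> x \in X.
Proof. by case/xpath_finE => y b1 yX b2; rewrite (fin_inj b2 b1). Qed.

Lemma xpath1 x : x \in X -> xpath [:: x].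
Proof. by rewrite /= => ->. Qed.

Lemma xpath_link a y b p q : xpath p -> xpath q -> fin a p -> beg b q ->
  e a y -> e y b -> xpath (p ++ y :: q).
Proof.
case: p => // x p /= /and3P [xX pp lX] xq f /begP [r qE] ay yb.
move: xq; rewrite {}qE /= => /and3P [bX pr lr]; rewrite xX cat_path pp /= yb pr last_cat /= lr !andbT.
case/finP: f => t xpt; suff -> : last x p = a by [].
by rewrite -[last x p]/(last a (x :: p)) xpt last_rcons.
Qed.

Lemma xpath_split L y R : xpath (L ++ y :: R) -> y \notin X ->
  exists a b, [/\ xpath L /\ xpath R, fin a L, beg b R, e a y & e y b].
Proof.
case: L => [|x L] /=; first by case: (y \in X).
case/and3P=> xX; rewrite cat_path last_cat /= => /andP [pL /andP [ey pR]] lR yX.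
case: R pR lR => [|b R] /=; first by rewrite (negbTE yX).
case/andP => yb pR lR; exists (last x L), b; split => //.
- have bX : b \in X by rewrite -(eX' yb).
  by rewrite xX pL bX pR lR (eX ey) yX.
- by rewrite (lastI x L) fin_rcons.
- exact: beg_cons.
Qed.

Lemma cyc_openY c y : xcyc c -> y \in c -> y \notin X ->
  exists p a b, [/\ perm_eq c (y :: p), xpath p, beg a p /\ fin b p, e y a & e b y].
Proof.
case/andP => cc sc yc yX; case: (rot_to yc) => i q rq.
have pq : perm_eq c (y :: q) by rewrite -rq perm_sym perm_rot.
have : cycle e (y :: q) by rewrite -rq rot_cycle.
have : 2 < size (y :: q) by rewrite -(perm_size pq).
case: q pq {rq} => // a q pq _ /=; rewrite rcons_path => /and3P [ya pa la].
exists (a :: q), a, (last a q); split => //.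
- by rewrite /= -(eX' ya) yX pa (eX la) yX.
- by split; [exact: beg_cons | rewrite (lastI a q) fin_rcons].
Qed.

(** Cutting at a vertex of X drops the neighbour [y] before it, so that both ends of what remains
    are in X. *)
Lemma cyc_openX c x : xcyc c -> x \in c -> x \in X ->
  exists y p, [/\ perm_eq c (y :: p), xpath p, beg x p & y \notin X].
Proof.
case/andP => cc sc xc xX; case: (rot_to xc) => i q rq.
have pq : perm_eq c (x :: q) by rewrite -rq perm_sym perm_rot.
have : cycle e (x :: q) by rewrite -rq rot_cycle.
have : 2 < size (x :: q) by rewrite -(perm_size pq).
case/lastP: q pq {rq} => // q y pq _.
rewrite /= !rcons_path last_rcons => /andP [/andP [pe ly] yx].
have yX : y \notin X by rewrite (eX' yx).
exists y, (x :: q); split => //.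
- by rewrite (perm_trans pq) // -rcons_cons perm_rcons.
- by rewrite /= xX pe (eX ly) yX.
- exact: beg_cons.
Qed.

(** * Covers, compared through the multiplicities of their vertices *)

Lemma flatten_cons p Ps : flatten (p :: Ps) = p ++ flatten Ps. Proof. by []. Qed.
Lemma count_cons z y p : count_mem z (y :: p) = (y == z) + count_mem z p.
Proof. by []. Qed.
Lemma count_nil z : count_mem z [::] = 0. Proof. by []. Qed.

Lemma count_catE z p q : count_mem z (p ++ q) = count_mem z p + count_mem z q.
Proof. exact: count_cat. Qed.
Lemma count_revE z p : count_mem z (rev p) = count_mem z p.
Proof. exact: count_rev. Qed.
Lemma count_perm p q : perm_eq p q -> forall z, count_mem z p = count_mem z q.
Proof. by move=> /permP pq z; apply: pq. Qed.

Definition countE := (flatten_cons, count_catE, count_cons, count_nil, count_revE).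

(** Rearranging paths gives an identity that is linear in the multiplicities of the pieces; once
    these are variables, [lia] decides it. *)
Ltac counts :=
  repeat match goal with |- context [?t] =>
    match t with count _ _ => generalize t; intro end end;
  repeat match goal with |- context [?t] =>
    match t with nat_of_bool _ => generalize t; intro end end;
  clear; lia.

Definition cells Ps Cs := flatten Ps ++ flatten Cs.

Definition cov Ps Cs : Prop :=
  [/\ all xpath Ps, all xcyc Cs, uniq (cells Ps Cs) & {subset X <= cells Ps Cs}].

Definition unused Ps Cs u := (u \notin X) && (u \notin cells Ps Cs).

Lemma uniq_count p : (forall z, count_mem z p <= 1) -> uniq p.
Proof.
elim: p => //= a p IH H; apply/andP; split; last first.
  by apply: IH => z; apply: leq_trans (H z); rewrite leq_addl.
by have := H a; rewrite eqxx add1n ltnS leqn0 => /eqP /count_memPn.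
Qed.

Lemma count_uniq1 p z : uniq p -> count_mem z p <= 1.
Proof. by move=> up; rewrite count_uniq_mem //; case: (z \in p). Qed.

(* [us] are the fresh and [ys] the abandoned vertices of Y. *)
Lemma cov_move us ys Ps Cs Ps' Cs' : cov Ps Cs ->
  all xpath Ps' -> all xcyc Cs' -> uniq us -> all (unused Ps Cs) us ->
  all (fun y => y \notin X) ys ->
  (forall z, count_mem z (cells Ps' Cs') + count_mem z ys =
             count_mem z (cells Ps Cs) + count_mem z us) ->
  cov Ps' Cs'.
Proof.
move=> [_ _ un sub] xP xC uu /allP au /allP ay H; split => //.
  apply: uniq_count => z.
  have := H z; have := count_uniq1 z un; have := count_uniq1 z uu.
  case: (boolP (z \in us)) => zu.
    by have /andP [_ /count_memPn ->] := au _ zu; lia.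
  by rewrite (count_memPn zu); lia.
move=> z zX; have := H z; rewrite -has_pred1 has_count.
have := sub _ zX; rewrite -has_pred1 has_count.
suff /count_memPn -> : z \notin ys by lia.
by apply/negP => /ay; rewrite zX.
Qed.

Definition rm P Ps : seq (seq V) := rem P Ps.

Lemma count_rm Ps P z : P \in Ps ->
  count_mem z (flatten Ps) = count_mem z P + count_mem z (flatten (rm P Ps)).
Proof. by move=> /perm_to_rem /perm_flatten /count_perm ->; rewrite countE. Qed.

Definition isend x p := beg x p || fin x p.

Lemma isend_rev x p : isend x (rev p) = isend x p.
Proof. by rewrite /isend beg_rev fin_rev orbC. Qed.

Lemma orient_fin x p : xpath p -> isend x p ->
  exists q, [/\ xpath q, fin x q & perm_eq q p].
Proof.
move=> xp /orP [bx|fx]; last by exists p.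
by exists (rev p); rewrite xpath_rev fin_rev perm_rev.
Qed.

Lemma orient_beg x p : xpath p -> isend x p ->
  exists q, [/\ xpath q, beg x q & perm_eq q p].
Proof.
move=> xp /orP [bx|fx]; first by exists p.
by exists (rev p); rewrite xpath_rev beg_rev perm_rev.
Qed.

Lemma xcyc_close a b u p : xpath p -> beg a p -> fin b p -> a != b ->
  e a u -> e b u -> xcyc (u :: p).
Proof.
move=> + /begP [q pE]; rewrite {}pE /= => /and3P [aX pq lX] fb ab au bu.
have lE : last a q = b by apply: fin_inj fb; rewrite (lastI a q) fin_rcons.
rewrite /xcyc /= e_sym au rcons_path pq lE bu /= !ltnS.
by case: q lE {fb pq lX} => //= ba; rewrite ba eqxx in ab.
Qed.

Lemma memPs_cells Ps Cs P z : P \in Ps -> z \in P -> z \in cells Ps Cs.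
Proof. by move=> PPs zP; rewrite mem_cat; apply/orP; left; apply/flattenP; exists P. Qed.

Lemma memCs_cells Ps Cs C z : C \in Cs -> z \in C -> z \in cells Ps Cs.
Proof. by move=> PPs zP; rewrite mem_cat; apply/orP; right; apply/flattenP; exists C. Qed.

Lemma mem_count z p : z \in p -> 0 < count_mem z p.
Proof. by rewrite -has_pred1 has_count. Qed.

Lemma mem_rm_neq Ps P Q : Q \in Ps -> Q != P -> Q \in rm P Ps.
Proof.
move=> Ql QP; case: (boolP (P \in Ps)) => Pl; last by rewrite /rm rem_id.
by have := perm_mem (perm_to_rem Pl) Q; rewrite Ql inE (negbTE QP).
Qed.

Lemma size_rm Ps P : P \in Ps -> size Ps = (size (rm P Ps)).+1.
Proof. by move=> Pl; rewrite size_rem //; case: Ps Pl. Qed.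

Section CovFacts.
Context (Ps Cs : seq (seq V)) (cv : cov Ps Cs).

Lemma cov_xpath P : P \in Ps -> xpath P.
Proof. by case: cv => /allP H _ _ _ /H. Qed.
Lemma cov_xcyc C : C \in Cs -> xcyc C.
Proof. by case: cv => _ /allP H _ _ /H. Qed.

Lemma cov_count z : count_mem z (flatten Ps) + count_mem z (flatten Cs) <= 1.
Proof. by rewrite -count_cat; apply: count_uniq1; case: cv. Qed.

Lemma cov_uniqP P : P \in Ps -> uniq P.
Proof.
by move=> PPs; apply: uniq_count => z; have := cov_count z; rewrite (count_rm z PPs); lia.
Qed.
Lemma cov_uniqC C : C \in Cs -> uniq C.
Proof.
by move=> PPs; apply: uniq_count => z; have := cov_count z; rewrite (count_rm z PPs); lia.
Qed.

Lemma cov_PP P Q z : P \in Ps -> Q \in Ps -> z \in P -> z \in Q -> P = Q.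
Proof.
move=> PPs QPs zP zQ; apply/eqP; apply/negPn/negP => PQ.
have QP : Q \in rm P Ps by apply: mem_rm_neq => //; rewrite eq_sym.
have := cov_count z; rewrite (count_rm z PPs) (count_rm z QP).
by have := mem_count zP; have := mem_count zQ; lia.
Qed.
Lemma cov_CC P Q z : P \in Cs -> Q \in Cs -> z \in P -> z \in Q -> P = Q.
Proof.
move=> PPs QPs zP zQ; apply/eqP; apply/negPn/negP => PQ.
have QP : Q \in rm P Cs by apply: mem_rm_neq => //; rewrite eq_sym.
have := cov_count z; rewrite (count_rm z PPs) (count_rm z QP).
by have := mem_count zP; have := mem_count zQ; lia.
Qed.
Lemma cov_PC P Q z : P \in Ps -> Q \in Cs -> z \in P -> z \in Q -> False.
Proof.
move=> PPs QCs zP zQ; have := cov_count z; rewrite (count_rm z PPs) (count_rm z QCs).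
by have := mem_count zP; have := mem_count zQ; lia.
Qed.

Lemma xpath_all_rem l r : all xpath l -> all xpath (rm r l).
Proof. by move=> /allP H; apply/allP => z /mem_rem /H. Qed.
Lemma xcyc_all_rem l r : all xcyc l -> all xcyc (rm r l).
Proof. by move=> /allP H; apply/allP => z /mem_rem /H. Qed.
Lemma cov_allP : all xpath Ps. Proof. by case: cv. Qed.
Lemma cov_allC : all xcyc Cs. Proof. by case: cv. Qed.
End CovFacts.

(** * Configurations excluded by the two minimal numbers *)

Context (p0 q0 : nat).
Context (p0_min : forall Ps Cs, cov Ps Cs -> p0 <= size Ps + size Cs).
Context (q0_min : forall Ps Cs, cov Ps Cs -> size Ps + size Cs = p0 -> q0 <= size Ps).

Definition tight Ps Cs := [/\ cov Ps Cs, size Ps + size Cs = p0 & size Ps = q0].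

(** Two different paths would be joined by [u], against [p0_min]. The two ends of one path would be
    closed by [u] to a cycle, which keeps the number of members but lowers that of paths, against
    [q0_min]. *)
Lemma ends_share Ps Cs P P' x x' u : tight Ps Cs -> P \in Ps -> P' \in Ps ->
  isend x P -> isend x' P' -> x != x' -> unused Ps Cs u -> e x u -> e x' u -> False.
Proof.
move=> [cv sp sq] PPs PPs' xP xP' xx un xu xu'.
have sP := size_rm PPs.
have cP z := count_rm z PPs.
case: (eqVneq P' P) => [PP|PP]; last first.
  have [P1 [x1 f1 pe1]] := orient_fin (cov_xpath cv PPs) xP.
  have [P2 [x2 f2 pe2]] := orient_beg (cov_xpath cv PPs') xP'.
  have PrP := mem_rm_neq PPs' PP.
  have sP2 := size_rm PrP.
  have cP2 z := count_rm z PrP.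
  have cv' : cov ((P1 ++ u :: P2) :: rm P' (rm P Ps)) Cs.
    apply: (cov_move (us := [:: u]) (ys := [::]) cv) => //=.
    - rewrite (xpath_link x1 x2 f1 f2) // 1?e_sym //.
      by do 2!apply: xpath_all_rem; exact: cov_allP cv.
    - exact: cov_allC cv.
    - by rewrite un.
    - move=> z; rewrite /cells !countE cP cP2 ?countE.
      by rewrite (count_perm pe1) (count_perm pe2) ?countE; counts.
  by move: (p0_min cv') sp sq sP sP2; clear => /=; lia.
have [a [b [P1 [x1 ba fb pe1] [ab [au bu]]]]] : exists a b, exists2 P1,
    [/\ xpath P1, beg a P1, fin b P1 & perm_eq P1 P] & a != b /\ e a u /\ e b u.
  rewrite {}PP in xP'; have xp := cov_xpath cv PPs.
  case/orP: xP => h1; case/orP: xP' => h2.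
  - by rewrite (beg_inj h1 h2) eqxx in xx.
  - by exists x, x'; exists P.
  - by exists x', x; exists P => //; rewrite eq_sym.
  - by rewrite (fin_inj h1 h2) eqxx in xx.
have cv' : cov (rm P Ps) ((u :: P1) :: Cs).
  apply: (cov_move (us := [:: u]) (ys := [::]) cv) => //=.
  - by apply: xpath_all_rem; exact: cov_allP cv.
  - by rewrite (xcyc_close x1 ba fb) //; exact: cov_allC cv.
  - by rewrite un.
  - move=> z; rewrite /cells !countE cP ?countE.
    by rewrite (count_perm pe1) ?countE; counts.
by move: (q0_min cv') sp sq sP; clear => /=; lia.
Qed.

(** Opening the cycle at [x'] and appending it to the path through [u] saves a member. *)
Lemma end_cyc_share Ps Cs P C x x' u : tight Ps Cs -> P \in Ps -> C \in Cs ->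
  isend x P -> x' \in C -> x' \in X -> unused Ps Cs u -> e x u -> e x' u -> False.
Proof.
move=> [cv sp sq] PPs CCs xP xC xX un xu xu'.
have sP := size_rm PPs. have sC := size_rm CCs.
have cP z := count_rm z PPs. have cC z := count_rm z CCs.
have [P1 [x1 f1 pe1]] := orient_fin (cov_xpath cv PPs) xP.
have [y [P2 [pe2 x2 b2 yX]]] := cyc_openX (cov_xcyc cv CCs) xC xX.
have cv' : cov ((P1 ++ u :: P2) :: rm P Ps) (rm C Cs).
  apply: (cov_move (us := [:: u]) (ys := [:: y]) cv) => //=.
  - rewrite (xpath_link x1 x2 f1 b2) // 1?e_sym //.
    by apply: xpath_all_rem; exact: cov_allP cv.
  - by apply: xcyc_all_rem; exact: cov_allC cv.
  - by rewrite un.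
  - by rewrite yX.
  - move=> z; rewrite /cells !countE cP cC ?countE.
    by rewrite (count_perm pe1) (count_perm pe2) ?countE; counts.
by move: (p0_min cv') sp sq sP sC; clear => /=; lia.
Qed.

Lemma cyc_cyc_share Ps Cs C C' x x' u : tight Ps Cs -> C \in Cs -> C' \in Cs -> C != C' ->
  x \in C -> x \in X -> x' \in C' -> x' \in X -> unused Ps Cs u -> e x u -> e x' u -> False.
Proof.
move=> [cv sp sq] CCs CCs' CC xC xX xC' xX' un xu xu'.
have sC := size_rm CCs. have cC z := count_rm z CCs.
have CCr : C' \in rm C Cs by apply: mem_rm_neq => //; rewrite eq_sym.
have sC' := size_rm CCr. have cC' z := count_rm z CCr.
have [y [P1 [pe1 x1 b1 yX]]] := cyc_openX (cov_xcyc cv CCs) xC xX.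
have [y' [P2 [pe2 x2 b2 yX']]] := cyc_openX (cov_xcyc cv CCs') xC' xX'.
have cv' : cov ((rev P1 ++ u :: P2) :: Ps) (rm C' (rm C Cs)).
  apply: (cov_move (us := [:: u]) (ys := [:: y; y']) cv) => //=.
  - rewrite (@xpath_link x u x') ?xpath_rev ?fin_rev //; last by rewrite e_sym.
    exact: cov_allP cv.
  - by do 2!apply: xcyc_all_rem; exact: cov_allC cv.
  - by rewrite un.
  - by rewrite yX yX'.
  - move=> z; rewrite /cells !countE cC cC' ?countE.
    by rewrite (count_perm pe1) (count_perm pe2) ?countE; counts.
by move: (p0_min cv') sp sq sC sC'; clear => /=; lia.
Qed.

(** Here [y] itself is the link: without [y] the cycle is a path that starts next to [y], so path
    and cycle merge without a fresh vertex. *)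
Lemma end_cyc_adj Ps Cs P C x y : tight Ps Cs -> P \in Ps -> C \in Cs ->
  isend x P -> y \in C -> e x y -> False.
Proof.
move=> [cv sp sq] PPs CCs xP yC xy.
have sP := size_rm PPs. have sC := size_rm CCs.
have cP z := count_rm z PPs. have cC z := count_rm z CCs.
have [P1 [x1 f1 pe1]] := orient_fin (cov_xpath cv PPs) xP.
have yX : y \notin X by rewrite -(eX xy) (fin_X x1 f1).
have [P2 [a [b [pe2 x2 [b2 _] ya _]]]] := cyc_openY (cov_xcyc cv CCs) yC yX.
have cv' : cov ((P1 ++ y :: P2) :: rm P Ps) (rm C Cs).
  apply: (cov_move (us := [::]) (ys := [::]) cv) => //=.
  - rewrite (xpath_link x1 x2 f1 b2) // 1?e_sym //.
    by apply: xpath_all_rem; exact: cov_allP cv.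
  - by apply: xcyc_all_rem; exact: cov_allC cv.
  - move=> z; rewrite /cells !countE cP cC ?countE.
    by rewrite (count_perm pe1) (count_perm pe2) ?countE; counts.
by move: (p0_min cv') sp sq sP sC; clear => /=; lia.
Qed.

Lemma cyc_cyc_adj Ps Cs C C' x y : tight Ps Cs -> C \in Cs -> C' \in Cs -> C != C' ->
  x \in C -> x \in X -> y \in C' -> e x y -> False.
Proof.
move=> [cv sp sq] CCs CCs' CC xC xX yC xy.
have sC := size_rm CCs. have cC z := count_rm z CCs.
have CCr : C' \in rm C Cs by apply: mem_rm_neq => //; rewrite eq_sym.
have sC' := size_rm CCr. have cC' z := count_rm z CCr.
have yX : y \notin X by rewrite -(eX xy).
have [y' [P1 [pe1 x1 b1 yX']]] := cyc_openX (cov_xcyc cv CCs) xC xX.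
have [P2 [a [b [pe2 x2 [b2 _] ya _]]]] := cyc_openY (cov_xcyc cv CCs') yC yX.
have cv' : cov ((rev P1 ++ y :: P2) :: Ps) (rm C' (rm C Cs)).
  apply: (cov_move (us := [::]) (ys := [:: y']) cv) => //=.
  - rewrite (@xpath_link x y a) ?xpath_rev ?fin_rev //.
    exact: cov_allP cv.
  - by do 2!apply: xcyc_all_rem; exact: cov_allC cv.
  - by rewrite yX'.
  - move=> z; rewrite /cells !countE cC cC' ?countE.
    by rewrite (count_perm pe1) (count_perm pe2) ?countE; counts.
by move: (p0_min cv') sp sq sC sC'; clear => /=; lia.
Qed.

(** * Consecutive triples, and relinking the head of a path *)

Definition step Q a y b := infix [:: a; y; b] Q.
Definition link3 Q a y b := step Q a y b || step Q b y a.
Definition link Ps a y b := has (fun Q => link3 Q a y b) Ps.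
Definition isE Ps z := has (isend z) Ps.

Lemma stepE Q a y b : step Q a y b ->
  exists L R, [/\ Q = L ++ y :: R, fin a L & beg b R].
Proof.
case/infixP => A [B ->]; exists (rcons A a), (b :: B).
by rewrite fin_rcons beg_cons cat_rcons.
Qed.

Lemma step_rev Q a y b : step (rev Q) a y b = step Q b y a.
Proof. by rewrite /step -infix_rev revK. Qed.

Lemma link3_rev Q a y b : link3 (rev Q) a y b = link3 Q a y b.
Proof. by rewrite /link3 !step_rev orbC. Qed.

Lemma link3C Q a y b : link3 Q a y b = link3 Q b y a.
Proof. by rewrite /link3 orbC. Qed.

Lemma step_adj Q a y b : xpath Q -> step Q a y b -> e a y /\ e y b.
Proof.
case: Q => // z Q /= /and3P [_ pQ _] /infixP [A [B]].
case: A => [|z' A] /= [zE QE]; move: pQ; rewrite QE ?cat_path /= ?zE.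
  by case/and3P.
by case/and5P.
Qed.

Lemma link3_adj Q a y b : xpath Q -> link3 Q a y b -> e a y /\ e y b.
Proof.
by move=> xQ /orP [] /(step_adj xQ) [h1 h2]; split => //; rewrite e_sym.
Qed.

Lemma step_mem Q a y b : step Q a y b -> [/\ a \in Q, y \in Q & b \in Q].
Proof.
by case/infixP => A [B ->]; rewrite !mem_cat !inE !eqxx !orbT.
Qed.
Lemma link3_mem Q a y b : link3 Q a y b -> [/\ a \in Q, y \in Q & b \in Q].
Proof. by case/orP => /step_mem []. Qed.

Lemma cat_split (A B C D : seq V) : A ++ B = C ++ D ->
  (exists E, A = C ++ E /\ D = E ++ B) \/ (exists E, C = A ++ E /\ B = E ++ D).
Proof.
elim: A C => [|a A IH] [|c C] /=.
- by move=> ->; left; exists [::].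
- by move=> ->; right; exists (c :: C).
- by move=> <-; left; exists (a :: A).
case=> -> /IH [[E [-> ->]]|[E [-> ->]]]; [left|right]; by exists E.
Qed.

Lemma step_split L y R a y' b : step (L ++ y :: R) a y' b ->
  y != a -> y != y' -> y != b -> step L a y' b || step R a y' b.
Proof.
case/infixP => A [B /cat_split H] ya yy yb; apply/orP.
case: H => [[E [LE E1]]|[E [_ E1]]].
  case: E LE E1 => [|a' [|y'' [|b' E]]] LE [].
  - by move=> h *; rewrite h eqxx in ya.
  - by move=> _ h *; rewrite h eqxx in yy.
  - by move=> _ _ h *; rewrite h eqxx in yb.
  by move=> h1 h2 h3 _; left; apply/infixP; exists A, E; rewrite LE h1 h2 h3.
case: E E1 => [|y0 E] /= [].
  by move=> h *; rewrite h eqxx in ya.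
by move=> _ ->; right; apply/infixP; exists E, B.
Qed.

Lemma link3_split L y R a y' b : link3 (L ++ y :: R) a y' b ->
  y != a -> y != y' -> y != b -> link3 L a y' b || link3 R a y' b.
Proof.
move=> /orP [] H h1 h2 h3.
  by case/orP: (step_split H h1 h2 h3) => H1; rewrite /link3 H1 ?orbT.
by case/orP: (step_split H h3 h2 h1) => H1; rewrite /link3 H1 ?orbT.
Qed.

Lemma link3_catl p q a y b : link3 p a y b -> link3 (p ++ q) a y b.
Proof. by case/orP => /(infix_catr q) H; apply/orP; [left|right]. Qed.
Lemma link3_catr p q a y b : link3 q a y b -> link3 (p ++ q) a y b.
Proof. by case/orP => /(infix_catl p) H; apply/orP; [left|right]. Qed.

Lemma isEP Ps z P : P \in Ps -> isend z P -> isE Ps z.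
Proof. by move=> PPs zP; apply/hasP; exists P. Qed.

(* The effect of linking an end [s] to a vertex next to the cut [y] through [h]. *)
Definition relinked Ps Cs Ps' s y h := [/\ tight Ps' Cs,
  forall z, isE Ps z -> z != s -> isE Ps' z,
  forall a y' b, y' \notin X -> y' != y -> link Ps a y' b -> link Ps' a y' b &
  forall u, unused Ps Cs u -> u != h -> unused Ps' Cs u].

Lemma link_X Ps Cs a y b : cov Ps Cs -> link Ps a y b -> y \notin X ->
  [/\ e a y, e y b, a \in X & b \in X].
Proof.
move=> cv /hasP [Q QPs /(link3_adj (cov_xpath cv QPs)) [ay yb]] yX.
by split => //; [rewrite (eX ay) yX | rewrite -(eX' yb)].
Qed.

(** The cut frees [y], which can then serve as the link itself; any other link is a fresh vertex,
    and [y] is abandoned. *)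
Definition usable Ps Cs y h := (h == y) || unused Ps Cs h.

Lemma unused_move us ys Ps Cs Ps' h u :
  (forall z, count_mem z (cells Ps' Cs) + count_mem z ys =
             count_mem z (cells Ps Cs) + count_mem z us) ->
  {subset us <= [:: h]} ->
  unused Ps Cs u -> u != h -> unused Ps' Cs u.
Proof.
move=> H sub /andP [uX /count_memPn u0] uh; rewrite /unused uX /=.
apply/count_memPn; have := H u; rewrite u0.
suff /count_memPn -> : u \notin us by lia.
by apply/negP => /sub; rewrite inE (negbTE uh).
Qed.

(** Two paths replace two, so the cover stays tight. The outer ends of [P] and [Q] survive, and [R]
    begins with the new end [x]. *)
Lemma op_foreign Ps Cs P Q Q' L y R s h xh x : tight Ps Cs ->
  P \in Ps -> Q \in Ps -> Q != P -> beg s P -> (Q' = Q \/ Q' = rev Q) ->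
  Q' = L ++ y :: R -> y \notin X -> fin xh L -> beg x R ->
  e s h -> e h xh -> usable Ps Cs y h ->
  relinked Ps Cs ((rev P ++ h :: rev L) :: R :: rm Q (rm P Ps)) s y h.
Proof.
move=> [cv sp sq] PPs QPs QP bs QQ QE yX fL bR sh hx us.
have QPr := mem_rm_neq QPs QP.
have sP := size_rm PPs; have sQ := size_rm QPr.
have cP z := count_rm z PPs; have cQ z := count_rm z QPr.
have xP := cov_xpath cv PPs.
have xQ' : xpath (L ++ y :: R).
  have xQ := cov_xpath cv QPs.
  by rewrite -QE; case: QQ => ->; rewrite ?xpath_rev.
have pQ : perm_eq Q (L ++ y :: R).
  by rewrite -QE; case: QQ => ->; rewrite // perm_sym perm_rev.
have [a [b [[xL xR] _ _ _ _]]] := xpath_split xQ' yX.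
have [us' [ys' [H sub uu au ay]]] : exists us' ys', [/\ forall z,
     count_mem z (cells ((rev P ++ h :: rev L) :: R :: rm Q (rm P Ps)) Cs) +
     count_mem z ys' = count_mem z (cells Ps Cs) + count_mem z us',
     {subset us' <= [:: h]}, uniq us', all (unused Ps Cs) us' &
     all (fun y => y \notin X) ys'].
  case/orP: us => [/eqP hy|un].
    exists [::], [::]; split => // z.
    by rewrite /cells !countE cP cQ (count_perm pQ) ?countE hy; counts.
  exists [:: h], [:: y]; split => //=; rewrite ?un ?yX // => z.
  by rewrite /cells !countE cP cQ (count_perm pQ) ?countE; counts.
have cv' : cov ((rev P ++ h :: rev L) :: R :: rm Q (rm P Ps)) Cs.
  apply: (cov_move cv _ _ uu au ay H); last exact: cov_allC cv.
  rewrite /= xR (@xpath_link s h xh) ?xpath_rev ?fin_rev //.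
  by do 2!apply: xpath_all_rem; exact: cov_allP cv.
have inPs A : A \in Ps -> [|| A == P, A == Q | A \in rm Q (rm P Ps)].
  move=> APs; case: (eqVneq A P) => //= AP; case: (eqVneq A Q) => //= AQ.
  by apply: mem_rm_neq => //; apply: mem_rm_neq.
split.
- by split => //; rewrite /= -?sq; move: sp sP sQ; clear; lia.
- move=> z /hasP [A /inPs /or3P [/eqP ->|/eqP ->|Ar] zA] zs.
  + apply: (isEP (mem_head _ _)); case/orP: zA => zP.
      by rewrite (beg_inj zP bs) eqxx in zs.
    by rewrite /isend beg_cat // beg_rev.
  + have : isend z (L ++ y :: R).
      by rewrite -QE; case: QQ => ->; rewrite ?isend_rev.
    case/orP => zQ.
      apply: (isEP (mem_head _ _)); rewrite /isend orbC fin_cat //.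
      by apply: fin_cons; rewrite fin_rev (beg_catl fL zQ).
    apply: (@isEP _ _ R); rewrite ?inE ?eqxx ?orbT // /isend; apply/orP; right.
    by apply: (fin_consr bR); apply: (fin_catr (beg_cons _ _) zQ).
  + by apply: (isEP _ zA); rewrite !inE Ar !orbT.
- move=> a' y' b' yX' yy lk.
  have [_ _ aX bX] := link_X cv lk yX'.
  case/hasP: lk => A /inPs /or3P [/eqP ->|/eqP ->|Ar] lk; apply/hasP.
  + exists (rev P ++ h :: rev L); first exact: mem_head.
    by apply: link3_catl; rewrite link3_rev.
  + have : link3 (L ++ y :: R) a' y' b'.
      by rewrite -QE; case: QQ => ->; rewrite ?link3_rev.
    have ya : y != a' by apply: contra yX => /eqP ->.
    have yb : y != b' by apply: contra yX => /eqP ->.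
    rewrite eq_sym in yy.
    case/link3_split/(_ ya yy yb)/orP => lk'.
      exists (rev P ++ h :: rev L); first exact: mem_head.
      by apply: link3_catr; apply: (@link3_catr [:: h]); rewrite link3_rev.
    by exists R => //; rewrite !inE eqxx orbT.
  + by exists A => //; rewrite !inE Ar !orbT.
- by move=> u; apply: unused_move H sub.
Qed.

(** This is a Pósa rotation: the initial part [L] is reversed and reattached at [s] through [h], so
    that [x] takes the place of [s] as head. *)
Lemma op_near Ps Cs P L y R s h xh x : tight Ps Cs ->
  P \in Ps -> beg s P -> P = L ++ y :: R -> y \notin X -> fin x L -> beg xh R ->
  e s h -> e h xh -> usable Ps Cs y h ->
  relinked Ps Cs ((rev L ++ h :: R) :: rm P Ps) s y h.
Proof.
move=> [cv sp sq] PPs bs PE yX fL bR sh hx us.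
have sP := size_rm PPs; have cP z := count_rm z PPs.
have xP : xpath (L ++ y :: R) by rewrite -PE; exact: (cov_xpath cv PPs).
have pP : perm_eq P (L ++ y :: R) by rewrite -PE.
have [a [b [[xL xR] _ _ _ _]]] := xpath_split xP yX.
have bsL : beg s L by apply: (beg_catl (q := y :: R) fL); rewrite -PE.
have [us' [ys' [H sub uu au ay]]] : exists us' ys', [/\ forall z,
     count_mem z (cells ((rev L ++ h :: R) :: rm P Ps) Cs) +
     count_mem z ys' = count_mem z (cells Ps Cs) + count_mem z us',
     {subset us' <= [:: h]}, uniq us', all (unused Ps Cs) us' &
     all (fun y => y \notin X) ys'].
  case/orP: us => [/eqP hy|un].
    exists [::], [::]; split => // z.
    by rewrite /cells !countE cP (count_perm pP) ?countE hy; counts.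
  exists [:: h], [:: y]; split => //=; rewrite ?un ?yX // => z.
  by rewrite /cells !countE cP (count_perm pP) ?countE; counts.
have cv' : cov ((rev L ++ h :: R) :: rm P Ps) Cs.
  apply: (cov_move cv _ _ uu au ay H); last exact: cov_allC cv.
  rewrite /= (@xpath_link s h xh) ?xpath_rev ?fin_rev //.
  by apply: xpath_all_rem; exact: cov_allP cv.
have inPs A : A \in Ps -> (A == P) || (A \in rm P Ps).
  by move=> APs; case: (eqVneq A P) => //= AP; apply: mem_rm_neq.
split.
- by split => //; rewrite /= -?sq; move: sp sP; clear; lia.
- move=> z /hasP [A /inPs /orP [/eqP ->|Ar] zA] zs.
  + apply: (isEP (mem_head _ _)); case/orP: zA => zP.
      by rewrite (beg_inj zP bs) eqxx in zs.
    rewrite /isend orbC fin_cat // fin_cons //; rewrite PE in zP.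
    by apply: (fin_consr bR); apply: (fin_catr (beg_cons _ _) zP).
  + by apply: (isEP _ zA); rewrite !inE Ar !orbT.
- move=> a' y' b' yX' yy lk.
  have [_ _ aX bX] := link_X cv lk yX'.
  case/hasP: lk => A /inPs /orP [/eqP ->|Ar] lk; apply/hasP.
  + rewrite PE in lk.
    have ya : y != a' by apply: contra yX => /eqP ->.
    have yb : y != b' by apply: contra yX => /eqP ->.
    rewrite eq_sym in yy; exists (rev L ++ h :: R); first exact: mem_head.
    case/link3_split/(_ ya yy yb)/orP: lk => lk'.
      by apply: link3_catl; rewrite link3_rev.
    by apply: link3_catr; apply: (@link3_catr [:: h]).
  + by exists A => //; rewrite !inE Ar !orbT.
- by move=> u; apply: unused_move H sub.
Qed.

(* The head [s] of [P] labels [x]: linking [s] through [h] to [xh] and cutting at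
   [y], where xh - y - x are consecutive, yields a cover of the same size with end
   [x]. If the cut is in [P] itself, [x] must lie on the side of [s]. *)
Definition lab Ps Cs P s h x y xh := [/\ y \notin X, e s h, e h xh, usable Ps Cs y h &
  (exists Q, [/\ Q \in Ps, Q != P & link3 Q xh y x]) \/ step P x y xh].

Lemma link3E Q a y b : link3 Q a y b -> exists Q' L R,
  [/\ Q' = Q \/ Q' = rev Q, Q' = L ++ y :: R, fin a L & beg b R].
Proof.
case/orP => [/stepE|]; first by case=> L [R [-> f b']]; exists (L ++ y :: R), L, R; split; auto.
by rewrite -step_rev => /stepE [L [R [QE f b']]]; exists (rev Q), L, R; split; auto.
Qed.

(** The last clause keeps the paths that the move does not touch, so that a second label can be used
    after the first. *)
Lemma op_lab Ps Cs P s h x y xh : tight Ps Cs -> P \in Ps -> beg s P ->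
  lab Ps Cs P s h x y xh -> exists Ps', [/\ relinked Ps Cs Ps' s y h, isE Ps' x &
    forall A, A \in Ps -> A != P -> y \notin A -> A \in Ps'].
Proof.
move=> tg PPs bs [yX sh hx us]; case=> [[Q [QPs QP lk]]|st].
  have [Q' [L [R [QQ QE fL bR]]]] := link3E lk.
  exists ((rev P ++ h :: rev L) :: R :: rm Q (rm P Ps)); split.
  - exact: (op_foreign tg PPs QPs QP bs QQ QE yX fL bR).
  - by apply: (@isEP _ _ R); rewrite ?inE ?eqxx ?orbT // /isend bR.
  - move=> A APs AP yA; rewrite !inE; apply/or3P; constructor 3.
    apply: mem_rm_neq; first exact: mem_rm_neq.
    by apply: contra yA => /eqP ->; case/link3_mem: lk.
have [L [R [PE fL bR]]] := stepE st.
exists ((rev L ++ h :: R) :: rm P Ps); split.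
- exact: (op_near tg PPs bs PE yX fL bR).
- by apply: (isEP (mem_head _ _)); rewrite /isend beg_cat // beg_rev.
- by move=> A APs AP yA; rewrite inE mem_rm_neq ?orbT.
Qed.

Lemma isE_share Ps Cs x x' u : tight Ps Cs -> isE Ps x -> isE Ps x' -> x != x' ->
  unused Ps Cs u -> e x u -> e x' u -> False.
Proof. by move=> tg /hasP [P ? ?] /hasP [P' ? ?]; apply: (@ends_share Ps Cs P P'). Qed.

Lemma isE_beg Ps P s : P \in Ps -> beg s P -> isE Ps s.
Proof. by move=> PPs bs; apply: (isEP PPs); rewrite /isend bs. Qed.

(** Relinking turns [x] into an end that shares [u] with the end [f]. The link is not [u], or else
    [s] and [f] would share [u] beforehand. *)
Lemma lab_free Ps Cs P s h x y xh f u : tight Ps Cs -> P \in Ps -> beg s P ->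
  lab Ps Cs P s h x y xh -> unused Ps Cs u -> e x u -> e f u ->
  isE Ps f -> f != s -> f != x -> False.
Proof.
move=> tg PPs bs lb un xu fu fE fs fx.
have hu : u != h.
  apply/eqP => uh; case: lb => _ sh _ _ _.
  by apply: (isE_share tg fE (isE_beg PPs bs) fs un) => //; rewrite uh.
have [Ps' [[tg' pe _ pu] xE _]] := op_lab tg PPs bs lb.
by apply: (isE_share tg' (pe _ fE fs) xE fx (pu _ un hu)).
Qed.

Lemma lab_free_cyc Ps Cs P s h x y xh f u C : tight Ps Cs -> P \in Ps -> beg s P ->
  lab Ps Cs P s h x y xh -> unused Ps Cs u -> e x u -> e f u ->
  C \in Cs -> f \in C -> f \in X -> False.
Proof.
move=> tg PPs bs lb un xu fu CCs fC fX.
have hu : u != h.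
  apply/eqP => uh; case: lb => _ sh _ _ _.
  apply: (@end_cyc_share Ps Cs P C s f u) => //; last by rewrite uh.
  by rewrite /isend bs.
have [Ps' [[tg' _ _ pu] /hasP [A APs xA] _]] := op_lab tg PPs bs lb.
by apply: (@end_cyc_share Ps' Cs A C x f u) => //; apply: pu.
Qed.

Lemma lab_cyc_adj Ps Cs P s h x y xh w C : tight Ps Cs -> P \in Ps -> beg s P ->
  lab Ps Cs P s h x y xh -> C \in Cs -> w \in C -> e x w -> False.
Proof.
move=> tg PPs bs lb CCs wC xw.
have [Ps' [[tg' _ _ _] /hasP [A APs xA] _]] := op_lab tg PPs bs lb.
exact: (@end_cyc_adj Ps' Cs A C x w).
Qed.

Lemma usable_cells Ps Cs y h : y \in cells Ps Cs -> usable Ps Cs y h ->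
  h = y \/ unused Ps Cs h /\ h != y.
Proof.
move=> yc /orP [/eqP ->|un]; [by left|right; split => //].
by apply/eqP => hy; rewrite /unused hy yc andbF in un.
Qed.

Lemma lab_cells Ps Cs P s h x y xh : P \in Ps -> lab Ps Cs P s h x y xh ->
  y \in cells Ps Cs.
Proof.
move=> PPs [_ _ _ _ [[Q [QPs _ /link3_mem [_ yQ _]]]|/step_mem [_ yP _]]];
  by [apply: (memPs_cells _ QPs)|apply: (memPs_cells _ PPs)].
Qed.

(** Both relinkings are carried out in turn, after which [x] and [x'] are ends sharing [u]. The
    first leaves [P'] alone because [y] is not on it, and the second label survives because only the
    triple around [y] is broken. *)
Lemma lab_lab_aux Ps Cs P s h x y xh P' s' h' x' y' xh' u : tight Ps Cs ->
  P \in Ps -> beg s P -> lab Ps Cs P s h x y xh ->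
  P' \in Ps -> beg s' P' -> lab Ps Cs P' s' h' x' y' xh' ->
  P != P' -> y \notin P' -> y != y' ->
  unused Ps Cs u -> e x u -> e x' u -> x != x' -> x != s' -> u != h -> u != h' -> False.
Proof.
move=> tg PPs bs lb PPs' bs' lb' PP yP yy un xu xu' xx xs uh uh'.
have cv : cov Ps Cs by case: tg.
have ss : s != s'.
  apply: contra PP => /eqP ss; apply/eqP; apply: (cov_PP cv PPs PPs' (beg_mem bs)).
  by rewrite ss beg_mem.
have hh : h' != h.
  apply/eqP => hh; have [yX sh _ us _] := lb; have [_ sh' _ us' _] := lb'.
  have yc := lab_cells PPs lb; have yc' := lab_cells PPs' lb'.
  case: (usable_cells yc us) => [hy|[un1 _]]; case: (usable_cells yc' us') => [hy'|[un2 _]].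
  - by rewrite -hy -hy' hh eqxx in yy.
  - by move: un2; rewrite /unused hh hy yc andbF.
  - by move: un1; rewrite /unused -hh hy' yc' andbF.
  - apply: (isE_share tg (isE_beg PPs bs) (isE_beg PPs' bs') ss un1 sh).
    by rewrite -hh.
have [Ps1 [[tg1 pe pl pu] xE keep]] := op_lab tg PPs bs lb.
have PPs1 : P' \in Ps1 by apply: keep => //; rewrite eq_sym.
have lb1 : lab Ps1 Cs P' s' h' x' y' xh'.
  case: lb' => yX sh hx us alt; split => //.
    by case/orP: us => [hy|un']; rewrite /usable ?hy // (pu _ un' hh) orbT.
  case: alt => [[Q [QPs QP lk]]|st]; [left|by right].
  have /hasP [Q1 Q1Ps lk1] : link Ps1 xh' y' x'.
    by apply: pl => //; [rewrite eq_sym | apply/hasP; exists Q].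
  exists Q1; split => //; apply: contra QP => /eqP Q1E; apply/eqP.
  apply: (cov_PP cv QPs PPs' (z := y')); first by case/link3_mem: lk.
  by rewrite -Q1E; case/link3_mem: lk1.
have [Ps2 [[tg2 pe2 _ pu2] xE2 _]] := op_lab tg1 PPs1 bs' lb1.
by apply: (isE_share tg2 (pe2 _ xE xs) xE2 xx (pu2 _ (pu _ un uh) uh')).
Qed.

(** * Optimal covers *)

Definition sqs Ps := sumn [seq size p * size p | p <- Ps].

Lemma sqs_rm Ps P : P \in Ps -> sqs Ps = size P * size P + sqs (rm P Ps).
Proof. by move=> /perm_to_rem /(perm_map (fun p => size p * size p)) /perm_sumn. Qed.

Context (s0 : nat) (s0_max : forall Ps Cs, tight Ps Cs -> sqs Ps <= s0).

Definition opt Ps Cs := tight Ps Cs /\ sqs Ps = s0.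

Lemma sqs_op Ps P Q (N R : seq V) : P \in Ps -> Q \in rm P Ps ->
  sqs (N :: R :: rm Q (rm P Ps)) + (size P * size P + size Q * size Q) =
  sqs Ps + (size N * size N + size R * size R).
Proof.
move=> PPs QPr; rewrite (sqs_rm PPs) (sqs_rm QPr).
by rewrite [sqs (N :: _)]/sqs /= -/(sqs (rm Q (rm P Ps))); lia.
Qed.

Lemma size_cut Q' Q L y R : Q' = Q \/ Q' = rev Q -> Q' = L ++ y :: R ->
  size Q = size L + (size R).+1.
Proof. by case=> -> QE; [|rewrite -size_rev]; rewrite QE size_cat. Qed.

(** The sizes |P| and |L| + 1 + |R| become |P| + 1 + |L| and |R|, so the sum of squares changes by
    2(|L| + 1)(|P| - |R|). *)
Lemma lopsided Ps Cs P Q Q' L y R s h xh x : opt Ps Cs ->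
  P \in Ps -> Q \in Ps -> Q != P -> beg s P -> (Q' = Q \/ Q' = rev Q) ->
  Q' = L ++ y :: R -> y \notin X -> fin xh L -> beg x R ->
  e s h -> e h xh -> usable Ps Cs y h -> size P <= size R.
Proof.
move=> [tg sqE] PPs QPs QP bs QQ QE yX fL bR sh hx us.
have [tg' _ _ _] := op_foreign tg PPs QPs QP bs QQ QE yX fL bR sh hx us.
have QPr := mem_rm_neq QPs QP.
have sQ := size_cut QQ QE.
have := s0_max tg'; have := sqs_op (rev P ++ h :: rev L) R PPs QPr.
rewrite sQ -sqE size_cat /= !size_rev; move: (sqs _) (sqs _) (size P) (size L) (size R).
by clear; nia.
Qed.

Lemma lab_lopsided Ps Cs P s h x y xh Q : opt Ps Cs -> P \in Ps -> beg s P ->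
  lab Ps Cs P s h x y xh -> Q \in Ps -> Q != P -> link3 Q xh y x ->
  exists Q' L R, [/\ Q' = Q \/ Q' = rev Q, Q' = L ++ y :: R, fin xh L, beg x R &
                     size P <= size R].
Proof.
move=> op PPs bs [yX sh hx us _] QPs QP lk.
have [Q' [L [R [QQ QE fL bR]]]] := link3E lk.
exists Q', L, R; split => //.
exact: (lopsided op PPs QPs QP bs QQ QE yX fL bR sh hx us).
Qed.

Lemma lab_size Ps Cs P s h x y xh Q : opt Ps Cs -> P \in Ps -> beg s P ->
  lab Ps Cs P s h x y xh -> Q \in Ps -> Q != P -> y \in Q -> size P < size Q.
Proof.
move=> op PPs bs lb QPs QP yQ.
have cv : cov Ps Cs by case: op => [[]].
have lk : link3 Q xh y x.
  case: (lb) => _ _ _ _ [[Q1 [Q1Ps _ lk]]|/step_mem [_ yP _]].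
    by rewrite (cov_PP cv QPs Q1Ps yQ) //; case/link3_mem: lk.
  by rewrite (cov_PP cv QPs PPs yQ yP) eqxx in QP.
have [Q' [L [R [QQ QE _ _ sR]]]] := lab_lopsided op PPs bs lb QPs QP lk.
by rewrite (size_cut QQ QE) addnS ltnS (leq_trans sR) // leq_addl.
Qed.

(** If each cut lay on the path of the other head, [lab_size] would make each path shorter than the
    other. So one cut misses the other path, and that relinking goes first. *)
Lemma lab_lab Ps Cs P s h x y xh P' s' h' x' y' xh' u : opt Ps Cs ->
  P \in Ps -> beg s P -> lab Ps Cs P s h x y xh ->
  P' \in Ps -> beg s' P' -> lab Ps Cs P' s' h' x' y' xh' ->
  P != P' -> y != y' -> unused Ps Cs u -> e x u -> e x' u -> x != x' ->
  (forall z, e z u -> ~~ isE Ps z) -> False.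
Proof.
move=> op PPs bs lb PPs' bs' lb' PP yy un xu xu' xx int.
have [tg _] := op.
have cv : cov Ps Cs by case: tg.
have uh : u != h.
  apply/eqP => uh; case: (lb) => _ sh _ _ _; rewrite -uh in sh.
  by have := int _ sh; rewrite (isE_beg PPs bs).
have uh' : u != h'.
  apply/eqP => uh'; case: (lb') => _ sh _ _ _; rewrite -uh' in sh.
  by have := int _ sh; rewrite (isE_beg PPs' bs').
have xs : x != s'.
  by apply: contra (int _ xu) => /eqP ->; exact: isE_beg PPs' bs'.
have xs' : x' != s.
  by apply: contra (int _ xu') => /eqP ->; exact: isE_beg PPs bs.
case: (boolP (y \in P')) => yP'; last first.
  exact: (lab_lab_aux tg PPs bs lb PPs' bs' lb' PP yP' yy un xu xu').
case: (boolP (y' \in P)) => yP; last first.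
  rewrite eq_sym in PP; rewrite eq_sym in yy; rewrite eq_sym in xx.
  exact: (lab_lab_aux tg PPs' bs' lb' PPs bs lb PP yP yy un xu' xu).
have h1 : size P < size P' by apply: (lab_size op PPs bs lb PPs' _ yP'); rewrite eq_sym.
have h2 := lab_size op PPs' bs' lb' PPs PP yP.
by have := ltn_trans h1 h2; rewrite ltnn.
Qed.

Lemma beg_fin_uniq p a : uniq p -> beg a p -> fin a p -> p = [:: a].
Proof.
move=> + /begP [q pE]; rewrite {}pE; case/lastP: q => [|q b] //= /andP [].
rewrite mem_rcons inE => /norP [ab _] _.
by rewrite -rcons_cons => /fin_inj /(_ (fin_rcons _ _)) => abE; rewrite abE eqxx in ab.
Qed.

Lemma step_beg Q a y b : uniq Q -> beg a Q -> step Q a y b -> exists R,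
  [/\ rev Q = R ++ y :: [:: a], fin b R & Q = a :: y :: rev R].
Proof.
move=> uQ bQ /stepE [L [R [QE fL bR]]]; exists (rev R).
have LE : L = [:: a].
  apply: (beg_fin_uniq _ _ fL).
    by move: uQ; rewrite QE cat_uniq => /and3P [].
  by apply: (beg_catl (q := y :: R) fL); rewrite -QE.
by rewrite QE LE rev_cons rev_cons fin_rev revK -!cats1 -catA.
Qed.

(* Otherwise [z] could glue [Q1] and [Q2] into one long path, leaving two short
   ones, and [sqs] would grow. *)
Lemma single_second Ps Cs z Q1 Q2 s1 y1 x1 h1 s2 y2 x2 h2 : opt Ps Cs ->
  [:: z] \in Ps -> Q1 \in Ps -> Q2 \in Ps -> Q1 != [:: z] -> Q2 != [:: z] ->
  Q1 != Q2 -> beg s1 Q1 -> step Q1 s1 y1 x1 -> beg s2 Q2 -> step Q2 s2 y2 x2 ->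
  e z h1 -> e h1 x1 -> usable Ps Cs y1 h1 ->
  e z h2 -> e h2 x2 -> usable Ps Cs y2 h2 -> h1 != h2 -> False.
Proof.
move=> op zPs Q1Ps Q2Ps Q1z Q2z QQ b1 st1 b2 st2 zh1 hx1 us1 zh2 hx2 us2 hh.
have [tg sqE] := op; have cv : cov Ps Cs by case: tg.
have x1P := cov_xpath cv Q1Ps; have x2P := cov_xpath cv Q2Ps.
have y1X : y1 \notin X by rewrite -(eX (step_adj x1P st1).1) (beg_X x1P b1).
have y2X : y2 \notin X by rewrite -(eX (step_adj x2P st2).1) (beg_X x2P b2).
have [R1 [R1E f1 Q1E]] := step_beg (cov_uniqP cv Q1Ps) b1 st1.
have [R2 [R2E f2 _]] := step_beg (cov_uniqP cv Q2Ps) b2 st2.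
have bz : beg z [:: z] by exact: beg_cons.
have [tg1 _ _ pu] := op_foreign tg zPs Q1Ps Q1z bz (or_intror erefl) R1E y1X f1
  (beg_cons _ _) zh1 hx1 us1.
set Ps1 := _ :: _ :: _ in tg1 pu.
(* The two new paths have sizes |Q1| and 1, as the two old ones, so the cover remains optimal. *)
have op1 : opt Ps1 Cs.
  split => //; have := sqs_op (rev [:: z] ++ h1 :: rev R1) [:: s1] zPs (mem_rm_neq Q1Ps Q1z).
  have sN : size (rev [:: z] ++ h1 :: rev R1) = size Q1.
    by rewrite Q1E size_cat /= !size_rev.
  by rewrite sN -sqE /=; move: (sqs _) (sqs _) (size Q1 * _); clear; lia.
have Q2N : Q2 != rev [:: z] ++ h1 :: rev R1.
  apply: contra Q2z => /eqP Q2E; apply/eqP; apply: (cov_PP cv Q2Ps zPs (z := z)).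
    by rewrite Q2E mem_head.
  exact: mem_head.
have Q2Ps1 : Q2 \in Ps1.
  by rewrite !inE; apply/or3P; constructor 3; do 2?apply: mem_rm_neq; rewrite // eq_sym.
have us2' : usable Ps1 Cs y2 h2.
  by case/orP: us2 => [hy|un]; rewrite /usable ?hy // (pu _ un) ?orbT // eq_sym.
(* Now [z] heads a path as long as [Q1]. Linking it into [Q2] cuts off only [s2], so its path should
   have at most one vertex. *)
have := lopsided op1 (mem_head _ _) Q2Ps1 Q2N (beg_cons z _) (or_intror erefl) R2E
  y2X f2 (beg_cons _ _) zh2 hx2 us2'.
by rewrite size_cat /= size_rev; case: (R1) f1.
Qed.

(** The vertex [s], with [u] and [u'] on its sides, replaces [w]. If [s] was alone on its path, a
    member is saved; otherwise [Q], the longer path by [lopsided], gains two vertices and [P] loses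
    two, and the sum of squares grows. *)
Lemma insert_end Ps Cs P Q Q' L w R s u u' x x' : opt Ps Cs ->
  P \in Ps -> Q \in Ps -> Q != P -> beg s P -> (Q' = Q \/ Q' = rev Q) ->
  Q' = L ++ w :: R -> w \notin X -> fin x L -> beg x' R -> u != u' ->
  unused Ps Cs u -> unused Ps Cs u' -> e s u -> e u x -> e s u' -> e u' x' -> False.
Proof.
move=> op PPs QPs QP bs QQ QE wX fL bR uu un un' su ux su' ux'.
have sPR : size P <= size R.
  by apply: (lopsided op PPs QPs QP bs QQ QE wX fL bR su ux); rewrite /usable un orbT.
have [[cv sp sq] sqE] := op.
have QPr := mem_rm_neq QPs QP.
have sP := size_rm PPs; have sQ := size_rm QPr.
have cP z := count_rm z PPs; have cQ z := count_rm z QPr.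
have xP := cov_xpath cv PPs.
have sX := beg_X xP bs.
have xQ' : xpath (L ++ w :: R).
  have xQ := cov_xpath cv QPs.
  by rewrite -QE; case: QQ => ->; rewrite ?xpath_rev.
have pQ : perm_eq Q (L ++ w :: R).
  by rewrite -QE; case: QQ => ->; rewrite // perm_sym perm_rev.
have [a [b [[xL xR] _ _ _ _]]] := xpath_split xQ' wX.
have xN : xpath (L ++ u :: s :: u' :: R).
  apply: (@xpath_link x u s) => //; rewrite ?beg_cons // 1?e_sym // 1?e_sym //.
  apply: (@xpath_link s u' x' [:: s]) => //; first by rewrite /= sX.
  exact: beg_cons.
have [P' PE] := begP bs; case: P' PE => [|y1 P2] PE.
  have cv' : cov ((L ++ u :: s :: u' :: R) :: rm Q (rm P Ps)) Cs.
    apply: (cov_move (us := [:: u; u']) (ys := [:: w]) cv).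
    - by rewrite /= xN; do 2!apply: xpath_all_rem; exact: cov_allP cv.
    - exact: cov_allC cv.
    - by rewrite /= inE uu.
    - by rewrite /= un un'.
    - by rewrite /= wX.
    - by move=> z; rewrite /cells !countE cP cQ (count_perm pQ) PE ?countE; counts.
  by move: (p0_min cv') sp sq sP sQ; clear => /=; lia.
have xP2 : xpath ([:: s] ++ y1 :: P2) by rewrite -[_ ++ _]PE.
have y1X : y1 \notin X by move: xP2 => /= /and3P [_ /andP [/eX <-]].
have [c [d [[_ {}xP2] _ _ _ _]]] := xpath_split xP2 y1X.
have cv' : cov ((L ++ u :: s :: u' :: R) :: P2 :: rm Q (rm P Ps)) Cs.
  apply: (cov_move (us := [:: u; u']) (ys := [:: w; y1]) cv).
  - by rewrite /= xN xP2; do 2!apply: xpath_all_rem; exact: cov_allP cv.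
  - exact: cov_allC cv.
  - by rewrite /= inE uu.
  - by rewrite /= un un'.
  - by rewrite /= wX y1X.
  - by move=> z; rewrite /cells !countE cP cQ (count_perm pQ) PE ?countE; counts.
have tg' : tight ((L ++ u :: s :: u' :: R) :: P2 :: rm Q (rm P Ps)) Cs.
  by split => //; move: sp sq sP sQ; clear => /=; lia.
have := s0_max tg'; have := sqs_op (L ++ u :: s :: u' :: R) P2 PPs QPr.
rewrite (size_cut QQ QE) -sqE size_cat /=; move: sPR; rewrite PE /=.
by move: (sqs _) (sqs _) (size P2) (size L) (size R); clear; nia.
Qed.

(** The part of [N] up to [y] closes to a cycle by the edge from [y] to [s], and the freed rest [R]
    is joined to [P] through [u]. The number of members is unchanged, with one path fewer. *)
Lemma far_cycle Ps Cs N L y R s xh x P f u : tight Ps Cs -> N \in Ps ->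
  N = L ++ y :: R -> y \notin X -> beg s N -> e s y -> 1 < size L -> fin xh L ->
  beg x R -> P \in Ps -> P != N -> isend f P -> unused Ps Cs u -> e x u -> e f u -> False.
Proof.
move=> [cv sp sq] NPs NE yX bs sy sL fL bR PPs PN fP un xu fu.
have NPr : N \in rm P Ps by apply: mem_rm_neq => //; rewrite eq_sym.
have sP := size_rm PPs; have sN := size_rm NPr.
have cP z := count_rm z PPs; have cN z := count_rm z NPr.
have xN := cov_xpath cv NPs; rewrite NE in xN.
have [a [b [[xL xR] fa _ ay _]]] := xpath_split xN yX.
have [P1 [x1 f1 pe1]] := orient_fin (cov_xpath cv PPs) fP.
have bL : beg s L by apply: (beg_catl (q := y :: R) fL); rewrite -NE.
have sx : s != xh.
  apply: contraTneq sL => sx; rewrite (@beg_fin_uniq L s) //; last by rewrite sx.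
  by have := cov_uniqP cv NPs; rewrite NE cat_uniq => /and3P [].
have xc : xcyc (y :: L).
  by apply: (xcyc_close xL bL fL sx sy); rewrite (fin_inj fL fa).
have cv' : cov ((P1 ++ u :: R) :: rm N (rm P Ps)) ((y :: L) :: Cs).
  apply: (cov_move (us := [:: u]) (ys := [::]) cv).
  - rewrite /= (xpath_link x1 xR f1 bR) // 1?e_sym //.
    by do 2!apply: xpath_all_rem; exact: cov_allP cv.
  - by rewrite /= xc; exact: cov_allC cv.
  - by [].
  - by rewrite /= un.
  - by [].
  - move=> z; rewrite /cells !countE cP cN (count_perm pe1) NE ?countE; counts.
by move: (q0_min cv') sp sq sP sN; clear => /=; lia.
Qed.

(** Linking [z] through [y] makes [x] an end and [z] the head of a longer path [N1]. If [z] still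
    labels [x'] through [y'], a second relinking yields two ends sharing [u]. Otherwise [x'] follows
    [y'] on [N1], and [far_cycle] joins what lies beyond [y'] to [R] through [u]. *)
Lemma single_two_feet Ps Cs z Q Q' y xh x y' xh' x' u : tight Ps Cs ->
  [:: z] \in Ps -> Q \in Ps -> Q != [:: z] -> link3 Q xh y x ->
  Q' \in Ps -> Q' != [:: z] -> link3 Q' xh' y' x' ->
  y \notin X -> y' \notin X -> e z y -> e z y' -> y != y' ->
  unused Ps Cs u -> e x u -> e x' u -> x != x' -> False.
Proof.
move=> tg zPs QPs Qz lk QPs' Qz' lk' yX yX' zy zy' yy un xu xu' xx.
have cv : cov Ps Cs by case: tg.
have [Q1 [L [R [QQ QE fL bR]]]] := link3E lk.
have yx : e y xh by rewrite e_sym; have [] := link3_adj (cov_xpath cv QPs) lk.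
have yx' : e y' xh' by rewrite e_sym; have [] := link3_adj (cov_xpath cv QPs') lk'.
have uc : usable Ps Cs y y by rewrite /usable eqxx.
have [tg1 pe pl pu] := op_foreign tg zPs QPs Qz (beg_cons _ _) QQ QE yX fL bR zy yx uc.
set N1 := rev [:: z] ++ y :: rev L in tg1 pe pl pu; set Ps1 := _ :: _ :: _ in tg1 pe pl pu.
have cv1 : cov Ps1 Cs by case: tg1.
have RPs1 : R \in Ps1 by rewrite !inE eqxx orbT.
have xE1 : isE Ps1 x by apply: (isEP RPs1); rewrite /isend bR.
have bN : beg z N1 by exact: beg_cons.
have uy : u != y.
  apply: contraTneq un => ->; rewrite /unused (memPs_cells _ QPs) ?andbF //.
  by case/link3_mem: lk.
have un1 := pu _ un uy.
have zx : x != z.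
  apply: contra Qz => /eqP xz; apply/eqP; apply: (cov_PP cv QPs zPs (z := z)).
    by rewrite -xz; case/link3_mem: lk.
  exact: mem_head.
have nolab : lab Ps1 Cs N1 z y' x' y' xh' -> False.
  move=> lb; have [Ps2 [[tg2 pe2 _ pu2] xE2 _]] := op_lab tg1 (mem_head _ _) bN lb.
  have uy' : u != y'.
    apply: contraTneq un => ->; rewrite /unused (memPs_cells _ QPs') ?andbF //.
    by case/link3_mem: lk'.
  exact: (isE_share tg2 (pe2 _ xE1 zx) xE2 xx (pu2 _ un1 uy')).
have /hasP [Q2 Q2Ps lk2] : link Ps1 xh' y' x'.
  by apply: pl; rewrite // 1?eq_sym //; apply/hasP; exists Q'.
case: (eqVneq Q2 N1) => [Q2N|Q2N]; last first.
  apply: nolab; split => //; first by rewrite /usable eqxx.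
  by left; exists Q2.
rewrite {}Q2N in lk2; case/orP: lk2 => st; last first.
  by apply: nolab; split => //; [rewrite /usable eqxx | right].
have [L2 [R2 [NE f2 b2]]] := stepE st.
apply: (@far_cycle Ps1 Cs N1 L2 y' R2 z xh' x' R x u) => //.
- exact: mem_head.
(* The successor of [z] on [N1] is [y], not [y'], so [L2] contains more than [z]. *)
- have bL2 : beg z L2 by apply: (beg_catl (q := y' :: R2) f2); rewrite -NE.
  case: (L2) bL2 NE => [|c [|]] // _; rewrite /N1 /= => -[_ yE _].
  by rewrite yE eqxx in yy.
- apply/eqP => RN; have : z \in R by rewrite RN mem_head.
  have : z \in N1 by exact: mem_head.
  have := cov_count cv1 z.
  rewrite !countE => h1 h2 h3; move: h1; have := mem_count h3.
  by rewrite eqxx; clear; lia.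
- by rewrite /isend bR.
Qed.

(** * Positions on a path *)

Definition nx Q a b := infix [:: a; b] Q.

Lemma nxP Q a b : reflect (exists A B, Q = A ++ a :: b :: B) (nx Q a b).
Proof.
apply: (iffP idP) => [/infixP [A [B ->]]|[A [B ->]]]; first by exists A, B.
by apply/infixP; exists A, B.
Qed.

Lemma nx_index Q a b : uniq Q -> nx Q a b -> index b Q = (index a Q).+1.
Proof.
move=> uQ /nxP [A [B QE]]; rewrite QE in uQ *.
move: uQ; rewrite cat_uniq => /and3P [_ /hasPn H /=].
rewrite inE negb_or -andbA => /and4P [ab aB bB _].
have aA : a \notin A by apply: (H a); rewrite inE eqxx.
have bA : b \notin A by apply: (H b); rewrite !inE eqxx orbT.
rewrite !index_cat (negbTE aA) (negbTE bA) /= eqxx (negbTE ab) eqxx; lia.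
Qed.

Lemma nx_mem Q a b : nx Q a b -> a \in Q /\ b \in Q.
Proof. by case/nxP => A [B ->]; rewrite !mem_cat !inE !eqxx !orbT. Qed.

Lemma index_injQ Q a b : a \in Q -> index a Q = index b Q -> a = b.
Proof.
move=> aQ ab; rewrite -(nth_index a aQ) ab nth_index //.
by rewrite -index_mem -ab index_mem.
Qed.

Lemma nx_fun Q a b b' : uniq Q -> nx Q a b -> nx Q a b' -> b = b'.
Proof.
move=> uQ h h'; apply: (@index_injQ Q); first by case: (nx_mem h).
by rewrite (nx_index uQ h) (nx_index uQ h').
Qed.

Lemma nx_inj Q a a' b : uniq Q -> nx Q a b -> nx Q a' b -> a = a'.
Proof.
move=> uQ h h'; apply: (@index_injQ Q); first by case: (nx_mem h).
by have := nx_index uQ h; rewrite (nx_index uQ h') => -[].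
Qed.

Lemma step_nx Q a y b : step Q a y b -> nx Q a y /\ nx Q y b.
Proof.
case/infixP => A [B ->]; split; apply/nxP.
  by exists A, (b :: B).
by exists (rcons A a), B; rewrite cat_rcons.
Qed.

Lemma fin_nx Q a b : uniq Q -> fin a Q -> ~~ nx Q a b.
Proof.
move=> uQ /finP [q QE]; apply/negP => h; have := nx_index uQ h.
have [_] := nx_mem h; rewrite -index_mem => + E; rewrite {}E QE size_rcons.
move: uQ; rewrite QE rcons_uniq => /andP [/negbTE aq _].
by rewrite -cats1 index_cat aq /= eqxx addn0 ltnn.
Qed.

Lemma nx_step Q a y b : uniq Q -> nx Q a y -> nx Q y b -> step Q a y b.
Proof.
move=> uQ /nxP [A [B QE]] h; case: B QE => [|b' B] QE.
  have fy : fin y Q by rewrite QE -cat_rcons cats1 fin_rcons.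
  by rewrite (negbTE (fin_nx b uQ fy)) in h.
have <- : b' = b.
  apply: (nx_fun uQ _ h); apply/nxP; exists (rcons A a), B.
  by rewrite QE cat_rcons.
by apply/infixP; exists A, B.
Qed.

Lemma nx_adj Q a b : xpath Q -> nx Q a b -> e a b.
Proof.
case: Q => // z Q /= /and3P [_ pQ _] /nxP [A [B]].
case: A => [|z' A] /= [zE QE]; move: pQ; rewrite QE ?cat_path /= ?zE.
  by case/andP.
by case/and4P.
Qed.

Lemma mid Q w : w \in Q -> ~~ isend w Q -> exists a b, nx Q a w /\ nx Q w b.
Proof.
move=> /splitPr [A B]; rewrite /isend negb_or.
case/lastP: A => [|A a]; first by rewrite /= beg_cons.
case: B => [|b B]; first by rewrite cats1 fin_rcons andbF.
move=> _; exists a, b; split; apply/nxP.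
  by exists A, (b :: B); rewrite cat_rcons.
by exists (rcons A a), B.
Qed.

Lemma isend_X Q w : xpath Q -> isend w Q -> w \in X.
Proof. by move=> xQ /orP [/(beg_X xQ)|/(fin_X xQ)]. Qed.

Lemma step_predU Q a y a' y' b : uniq Q -> step Q a y b -> step Q a' y' b ->
  a = a' /\ y = y'.
Proof.
move=> uQ /step_nx [h1 h2] /step_nx [h3 h4].
have yy := nx_inj uQ h2 h4; rewrite -yy in h3.
by split => //; apply: nx_inj h1 h3.
Qed.

Lemma step_succU Q a y b y' b' : uniq Q -> step Q a y b -> step Q a y' b' ->
  y = y' /\ b = b'.
Proof.
move=> uQ /step_nx [h1 h2] /step_nx [h3 h4].
have yy := nx_fun uQ h1 h3; rewrite -yy in h4.
by split => //; apply: nx_fun h2 h4.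
Qed.

Lemma step_midU Q a y b a' b' : uniq Q -> step Q a y b -> step Q a' y b' ->
  a = a' /\ b = b'.
Proof.
move=> uQ /step_nx [h1 h2] /step_nx [h3 h4].
by split; [apply: nx_inj h1 h3 | apply: nx_fun h2 h4].
Qed.

Lemma step_index Q a y b : uniq Q -> step Q a y b -> index b Q = (index a Q).+2.
Proof. by move=> uQ /step_nx [/(nx_index uQ) h1 /(nx_index uQ)]; rewrite h1. Qed.

Lemma step_neq Q a y b : uniq Q -> step Q a y b -> a != b.
Proof. by move=> uQ /(step_index uQ) h; apply: contra_eq_neq h => ->; lia. Qed.

Lemma link3_neq Q a y b : uniq Q -> link3 Q a y b -> a != b.
Proof. by move=> uQ /orP [] /(step_neq uQ); rewrite // eq_sym. Qed.

Lemma beg_nx Q a b : uniq Q -> beg b Q -> ~~ nx Q a b.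
Proof.
move=> uQ bQ; apply/negP => h; have := nx_index uQ h.
by case/begP: bQ => q ->; rewrite /= eqxx.
Qed.

Lemma beg_second Q a : xpath Q -> beg a Q -> 1 < size Q -> exists y b, step Q a y b.
Proof.
move=> + /begP [q QE]; rewrite {}QE; case: q => [|y [|b q]] //=.
  by move=> /and3P [aX /andP [ay _] yX] _; rewrite (eX ay) yX in aX.
by move=> _ _; exists y, b; apply/infixP; exists [::], q.
Qed.

(** * Degree three, and the neighbourhoods of vertices in an optimal cover *)

Context (deg3 : forall v, #|nbr e v| = 3).

Lemma deg_eq v a b c d : e v a -> e v b -> e v c -> a != b -> a != c -> b != c ->
  e v d -> [|| d == a, d == b | d == c].
Proof.
move=> va vb vc ab ac bc vd.
have sub : [set a; b; c] \subset nbr e v.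
  by apply/subsetP => z; rewrite !inE => /orP [/orP [] |] /eqP ->.
have card : #|[set a; b; c]| = 3.
  by rewrite setUC cardsU1 !inE cards2 negb_or ![c == _]eq_sym ac bc ab.
have /eqP E : [set a; b; c] == nbr e v by rewrite eqEcard sub deg3 card.
have : d \in nbr e v by rewrite inE.
by rewrite -E !inE -orbA.
Qed.

Lemma beg_index Q a : beg a Q -> index a Q = 0.
Proof. by case/begP => q ->; rewrite /= eqxx. Qed.

Lemma index_beg Q a : a \in Q -> index a Q = 0 -> beg a Q.
Proof.
case: Q => // b Q _ /=; case: eqP => // -> _; exact: beg_cons.
Qed.

Lemma link3_midU Q x y b v c : uniq Q -> link3 Q x y b -> link3 Q v y c ->
  (v = x /\ c = b) \/ (v = b /\ c = x).
Proof.
move=> uQ /orP [] h1 /orP [] h2; have [] := step_midU uQ h1 h2; by auto.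
Qed.

Section Optimal.
Context (Ps Cs : seq (seq V)) (op : opt Ps Cs).

Lemma opt_tight : tight Ps Cs. Proof. by case: op. Qed.
Lemma opt_cov : cov Ps Cs. Proof. by case: opt_tight. Qed.
Notation tg := opt_tight.
Notation cv := opt_cov.

Definition pof w := nth [::] Ps (find (fun Q => w \in Q) Ps).
Definition inner w := [&& w \in X, w \in flatten Ps & ~~ isE Ps w].
Definition heads := [set w | (w \in flatten Ps) && beg w (pof w)].
(** Indices start at 0 and paths alternate from X on, so index 2 is the second vertex of X on the
    path. *)
Definition second w := index w (pof w) == 2.
Definition ntype u := unused Ps Cs u && [forall x, e u x ==> inner x].

Lemma pofP w : w \in flatten Ps -> pof w \in Ps /\ w \in pof w.
Proof.
case/flattenP => Q QPs wQ.
have h : has (fun Q => w \in Q) Ps by apply/hasP; exists Q.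
by split; [apply: mem_nth; rewrite -has_find | exact: (nth_find [::] h)].
Qed.

Lemma pofE Q w : Q \in Ps -> w \in Q -> pof w = Q.
Proof.
move=> QPs wQ; have wf : w \in flatten Ps by apply/flattenP; exists Q.
by have [h1 h2] := pofP wf; exact: (cov_PP cv h1 QPs h2 wQ).
Qed.

Lemma mem_flat Q w : Q \in Ps -> w \in Q -> w \in flatten Ps.
Proof. by move=> QPs wQ; apply/flattenP; exists Q. Qed.

Lemma headP s : s \in heads -> [/\ pof s \in Ps, beg s (pof s), isE Ps s & s \in X].
Proof.
rewrite inE => /andP [/pofP [h1 _] h2]; split => //; first exact: isE_beg h1 h2.
exact: beg_X (cov_xpath cv h1) h2.
Qed.

Lemma head_inj s s' : s \in heads -> s' \in heads -> pof s = pof s' -> s = s'.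
Proof. by move=> /headP [_ b _ _] /headP [_ b' _ _] h; apply: beg_inj b _; rewrite h. Qed.

Lemma innerP w : inner w ->
  [/\ w \in X, pof w \in Ps, w \in pof w, uniq (pof w) & ~~ isE Ps w].
Proof. by case/and3P => ? /pofP [h ?] ?; split => //; apply: cov_uniqP cv _ h. Qed.

Lemma inner_mid w : inner w -> exists a y y' b,
  [/\ step (pof w) a y w, step (pof w) w y' b & y != y'].
Proof.
case/innerP => wX QPs wQ uQ wE; have xQ := cov_xpath cv QPs.
have nE : ~~ isend w (pof w) by apply: contra wE; exact: isEP.
have [y [y' [n1 n2]]] := mid wQ nE.
have yX : y \notin X by rewrite (eX' (nx_adj xQ n1)).
have yX' : y' \notin X by rewrite -(eX (nx_adj xQ n2)).
have [a [_ [n3 _]]] := mid (nx_mem n1).1 (contra (isend_X xQ) yX).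
have [_ [b [_ n4]]] := mid (nx_mem n2).2 (contra (isend_X xQ) yX').
have s1 := nx_step uQ n3 n1; have s2 := nx_step uQ n2 n4.
exists a, y, y', b; split => //; apply: contraTneq s1 => ->.
apply/negP => s3; have [aw _] := step_midU uQ s3 s2.
by have := step_neq uQ s3; rewrite aw eqxx.
Qed.

(** Two of the three neighbours of [w] are those along its path, so [z] is the only other one. *)
Lemma inner_nbr w z v : inner w -> e w z -> z \notin flatten Ps -> e w v ->
  v != z -> exists b, link3 (pof w) w v b.
Proof.
move=> iw wz zf wv vz; have [_ QPs _ _ _] := innerP iw; have xQ := cov_xpath cv QPs.
have [a [y [y' [b [s1 s2 yy]]]]] := inner_mid iw.
have yQ : y \in pof w by case: (step_mem s1).
have yQ' : y' \in pof w by case: (step_mem s2).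
have ne t : t \in pof w -> t != z by move=> tQ; apply: contraNneq zf => <-; exact: mem_flat tQ.
have wy : e w y by rewrite e_sym; case: (step_adj xQ s1).
have wy' : e w y' by case: (step_adj xQ s2).
case/or3P: (deg_eq wy wy' wz yy (ne _ yQ) (ne _ yQ') wv) => /eqP vE.
- by exists a; rewrite vE /link3 s1 orbT.
- by exists b; rewrite vE /link3 s2.
- by rewrite vE eqxx in vz.
Qed.

Lemma inner_off w z z' : inner w -> e w z -> z \notin flatten Ps -> e w z' ->
  z' \notin flatten Ps -> z' = z.
Proof.
move=> iw wz zf wz' zf'; apply/eqP/negPn/negP => zz.
have [b /link3_mem [_ zQ _]] := inner_nbr iw wz zf wz' zz.
have [_ QPs _ _ _] := innerP iw.
by rewrite (mem_flat QPs zQ) in zf'.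
Qed.

Lemma unused_flat u : unused Ps Cs u -> u \notin flatten Ps.
Proof. by case/andP => _; apply: contra => h; rewrite mem_cat h. Qed.

Lemma inner_unusedU w u u' : inner w -> unused Ps Cs u -> unused Ps Cs u' ->
  e w u -> e w u' -> u = u'.
Proof.
by move=> iw /unused_flat un /unused_flat un' wu wu'; apply: (inner_off iw wu' _ wu).
Qed.

Lemma pathY Q y : Q \in Ps -> y \in Q -> y \notin X -> exists a b, step Q a y b.
Proof.
move=> QPs yQ yX; have xQ := cov_xpath cv QPs.
have [a [b [n1 n2]]] := mid yQ (contra (isend_X xQ) yX).
by exists a, b; apply: nx_step n1 n2; apply: cov_uniqP cv _ QPs.
Qed.

Lemma X_cases x : x \in X ->
  [\/ inner x, isE Ps x | exists2 C, C \in Cs & x \in C].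
Proof.
move=> xX; have [_ _ _ /(_ x xX)] := cv.
rewrite mem_cat => /orP [xf|/flattenP [C]]; last by constructor 3; exists C.
case: (boolP (isE Ps x)) => xE; first by constructor 2.
by constructor 1; rewrite /inner xX xf.
Qed.

Lemma unused_X u x : unused Ps Cs u -> e u x -> x \in X.
Proof. by case/andP => uX _ /eX' <-. Qed.

Lemma ntypeP u x : ntype u -> e u x -> inner x.
Proof. by case/andP => _ /forallP /(_ x) /implyP. Qed.

Lemma lab_link P s h x y xh : lab Ps Cs P s h x y xh -> P \in Ps ->
  exists2 Q, Q \in Ps & link3 Q xh y x.
Proof.
case=> _ _ _ _ [[Q [QPs _ lk]]|st] PPs; first by exists Q.
by exists P => //; rewrite /link3 st orbT.
Qed.

(** Different cut vertices contradict [lab_lab]. With a common cut vertex [y], the labels read one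
    triple in opposite directions and both links are [y] itself, so [y] would be adjacent to [x],
    [x'], [s] and [s']. *)
Lemma ntype_lab_head u s h x y xh s' h' x' y' xh' : ntype u ->
  s \in heads -> lab Ps Cs (pof s) s h x y xh ->
  s' \in heads -> lab Ps Cs (pof s') s' h' x' y' xh' ->
  e u x -> e u x' -> x != x' -> s = s'.
Proof.
move=> nu hs lb hs' lb' ux ux' xx; apply/eqP/negPn/negP => ss.
have [PPs bs sE _] := headP hs; have [PPs' bs' sE' _] := headP hs'.
have un : unused Ps Cs u by case/andP: nu.
have PP : pof s != pof s' by apply: contra ss => /eqP /(head_inj hs hs') ->.
have int z : e z u -> ~~ isE Ps z.
  by rewrite e_sym => /(ntypeP nu) /innerP [].
have noend z : isE Ps z -> e z u -> False by move=> zE /int; rewrite zE.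
case: (eqVneq y y') => [yy|yy]; last first.
  by apply: (lab_lab op PPs bs lb PPs' bs' lb' PP yy un _ _ xx int); rewrite e_sym.
rewrite -{}yy in lb'.
have [Q QPs lk] := lab_link lb PPs; have [Q' QPs' lk'] := lab_link lb' PPs'.
have [_ yQ _] := link3_mem lk; have [_ yQ' _] := link3_mem lk'.
have QQ := cov_PP cv QPs QPs' yQ yQ'; rewrite -{}QQ in lk'.
have uQ := cov_uniqP cv QPs.
case: (link3_midU uQ lk lk') => -[E1 E2]; first by rewrite E2 eqxx in xx.
subst xh' x'.
have [yX sh hx us _] := lb; have [_ sh' hx' us' _] := lb'.
have yc := lab_cells PPs lb; have xQ := cov_xpath cv QPs.
have used t r v w : isE Ps t -> inner v -> e u v -> e t r -> e r v -> w \in cells Ps Cs ->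
    usable Ps Cs w r -> r = w.
  move=> tE iv uv tr rv wc /(usable_cells wc) [//|[rn _]].
  have ru : r = u by apply: (inner_unusedU iv) => //; rewrite e_sym.
  by rewrite ru in tr; case: (noend t).
have hy := used _ _ _ _ sE (ntypeP nu ux') ux' sh hx yc us.
have hy' := used _ _ _ _ sE' (ntypeP nu ux) ux sh' hx' yc us'.
rewrite hy in sh; rewrite hy' in sh'.
have [xhy yx] := link3_adj xQ lk.
have ne v t : e u v -> isE Ps t -> v != t.
  by move=> uv tE; apply: contraTneq uv => ->; apply/negP; rewrite e_sym; exact: noend.
have yxh : e y xh by rewrite e_sym.
have ys : e y s by rewrite e_sym.
have ys' : e y s' by rewrite e_sym.
have := deg_eq yx yxh ys xx (ne _ _ ux sE) (ne _ _ ux' sE) ys'.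
by rewrite ![s' == _]eq_sym (negbTE (ne _ _ ux sE')) (negbTE (ne _ _ ux' sE')) (negbTE ss).
Qed.

(** * Labels issued by the head of a path *)

(** The vertex [x] is meant to replace [s]. A second vertex is ruled out because it has a common
    neighbour with the head of its path. *)
Definition deep s u x := [&& unused Ps Cs u && e s u, e u x, inner x, pof x != pof s
  & ~~ second x].
Definition bent := [set s in heads | [exists u, exists x, deep s u x]].
Definition plain := heads :\: bent.

Lemma plain_heads s : s \in plain -> s \in heads.
Proof. by rewrite inE => /andP []. Qed.

Lemma bent_heads s : s \in bent -> s \in heads.
Proof. by rewrite inE => /andP []. Qed.

Lemma head_inner s u x : isE Ps s -> unused Ps Cs u -> e s u -> e u x -> x != s ->
  inner x.
Proof.
move=> sE un su ux xs; have xu : e x u by rewrite e_sym.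
have xX := unused_X un ux.
case: (X_cases xX) => // [xE|[C CCs xC]].
  by case: (isE_share tg xE sE xs un xu su).
have /hasP [P PPs sP] := sE.
by case: (end_cyc_share tg PPs CCs sP xC xX un su xu).
Qed.

Lemma size1_beg s P : beg s P -> size P <= 1 -> P = [:: s].
Proof. by case/begP => -[|b q] ->. Qed.

(** Linking [s] to a second vertex [x] cuts off only the head of that path, and [lopsided] leaves
    [s] no more than one vertex. *)
Lemma plain_far s u x : s \in plain -> unused Ps Cs u -> e s u -> e u x -> inner x ->
  pof x != pof s -> second x /\ pof s = [:: s].
Proof.
move=> sp un su ux ix ps; have hs := plain_heads sp.
have sx : second x.
  apply: contraTT sp => nsx; rewrite !in_setD negb_and negbK.
  apply/orP; left; rewrite inE hs /=.
  by apply/existsP; exists u; apply/existsP; exists x; apply/and5P; split; rewrite ?un.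
split => //; have [PPs bs _ _] := headP hs.
have [_ QPs xQ uQ _] := innerP ix; have xpQ := cov_xpath cv QPs.
have [a [y [_ [_ [st _ _]]]]] := inner_mid ix.
have ba : beg a (pof x).
  apply: index_beg; first by case: (step_mem st).
  by have := step_index uQ st; rewrite (eqP sx) => -[].
have [R [RE fR _]] := step_beg uQ ba st.
have yX : y \notin X by rewrite -(eX (step_adj xpQ st).1) (beg_X xpQ ba).
apply: (size1_beg bs); apply: (lopsided op PPs QPs ps bs (or_intror erefl) RE yX fR
  (beg_cons _ _) su ux).
by rewrite /usable un orbT.
Qed.

Lemma plain_near s u x : s \in plain -> 1 < size (pof s) -> unused Ps Cs u ->
  e s u -> e u x -> x != s -> inner x /\ pof x = pof s.
Proof.
move=> sp sz un su ux xs; have [_ _ sE _] := headP (plain_heads sp).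
have ix := head_inner sE un su ux xs; split => //.
apply/eqP/negPn/negP => ps; have [_ pE] := plain_far sp un su ux ix ps.
by rewrite pE in sz.
Qed.

Context (iu ix : V -> V) (ixP : forall s, s \in bent -> deep s (iu s) (ix s)).

(* [g] picks, for each unused neighbour [u] of [s], a neighbour of [u] on the path
   of [s] that [s] does not label. *)
Definition guide s (g : V -> V) := s \in plain -> 1 < size (pof s) ->
  (forall u, unused Ps Cs u -> e s u -> [/\ inner (g u), e u (g u), pof (g u) = pof s
     & forall y b, step (pof s) (g u) y b -> ~~ e s y]) /\
  (forall u u' y, unused Ps Cs u -> unused Ps Cs u' -> e s u -> e s u' ->
     ~~ step (pof s) (g u') y (g u)).

Context (G : V -> V -> V) (GP : forall s, guide s (G s)).

(* [s] labels [x] through its neighbour [z]: [z] lies next to [x] on another path,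
   or just after [x] on the path of [s], or is unused and leads to the vertex
   picked by [G] that follows [x]. *)
Definition labz s z x := e s z &&
  [|| [exists b, link3 (pof x) x z b] && (pof x != pof s), [exists b, step (pof s) x z b]
    | unused Ps Cs z && [exists y, step (pof s) x y (G s z)]].

(** For a bent head only the labels issued through the selected link [iu s] and vertex [ix s] are
    recorded. *)
Definition LAB s x := if s \in bent then [exists y, link3 (pof x) x y (ix s)]
  else [exists z, labz s z x].

Lemma step_size Q a y b : step Q a y b -> 2 < size Q.
Proof. by case/infixP => A [B ->]; rewrite size_cat /=; lia. Qed.

Lemma labz_lab s z x : s \in plain -> inner x -> labz s z x ->
  exists h y xh, lab Ps Cs (pof s) s h x y xh.
Proof.
move=> sp ix' /andP [sz].
have [PPs bs sE sX] := headP (plain_heads sp); have [xX QPs xQ uQ _] := innerP ix'.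
have zX : z \notin X by rewrite -(eX sz).
case/or3P => [/andP [/existsP [b lk] ps]|/existsP [b st]|/andP [un /existsP [y st]]].
- have [xz zb] := link3_adj (cov_xpath cv QPs) lk.
  exists z, z, b; split; rewrite // /usable ?eqxx //; left.
  by exists (pof x); split => //; rewrite link3C.
- have [xz zb] := step_adj (cov_xpath cv PPs) st.
  by exists z, z, b; split; rewrite // /usable ?eqxx //; right.
- have [/(_ z un sz) [_ zg _ _] _] := GP sp (ltnW (step_size st)).
  have [xy _] := step_adj (cov_xpath cv PPs) st.
  exists z, y, (G s z); split; rewrite // /usable ?un ?orbT //; last by right.
  by rewrite -(eX xy).
Qed.

Lemma LAB_plain s x : s \in plain -> LAB s x -> exists z, labz s z x.
Proof. by rewrite inE /LAB => /andP [/negbTE -> _] /existsP. Qed.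

Lemma LAB_lab s x : s \in heads -> inner x -> LAB s x ->
  exists h y xh, lab Ps Cs (pof s) s h x y xh.
Proof.
move=> hs ix' lb; case: (boolP (s \in bent)) => sb; last first.
  have sp : s \in plain by rewrite inE sb.
  by have [z lz] := LAB_plain sp lb; exact: labz_lab lz.
have [xX QPs xQ uQ _] := innerP ix'.
have /and5P [/andP [un su] ux _ ps _] := ixP sb.
move: lb; rewrite /LAB sb => /existsP [y lk].
have [_ yQ iQ] := link3_mem lk; rewrite (pofE QPs iQ) in ps.
have [xy _] := link3_adj (cov_xpath cv QPs) lk.
exists (iu s), y, (ix s); split; rewrite // /usable ?un ?orbT //; first by rewrite -(eX xy).
by left; exists (pof x); split => //; rewrite link3C.
Qed.

Lemma labz_used s z x : s \in plain -> inner x -> ~~ unused Ps Cs z -> labz s z x -> e z x.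
Proof.
move=> sp ix' /negbTE un /andP [sz]; rewrite un orbF.
have [PPs bs sE sX] := headP (plain_heads sp); have [xX QPs xQ uQ _] := innerP ix'.
rewrite e_sym; case/orP => [/andP [/existsP [b lk] _]|/existsP [b st]].
  by case: (link3_adj (cov_xpath cv QPs) lk).
by case: (step_adj (cov_xpath cv PPs) st).
Qed.

Lemma labz_unused s z x : s \in plain -> inner x -> unused Ps Cs z -> labz s z x ->
  exists y, step (pof s) x y (G s z).
Proof.
move=> sp ix' un /andP [sz]; rewrite un.
have [PPs bs sE sX] := headP (plain_heads sp); have [xX QPs xQ uQ _] := innerP ix'.
have zf := unused_flat un.
case/or3P => [/andP [/existsP [b lk] _]|/existsP [b st]|/existsP //].
  by case/negP: zf; apply: (mem_flat QPs); case/link3_mem: lk.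
by case/negP: zf; apply: (mem_flat PPs); case/step_mem: st.
Qed.

Lemma labz_card s z : s \in plain -> e s z ->
  #|[set x | inner x && labz s z x]| <= 2.
Proof.
move=> sp sz; have [PPs bs sE sX] := headP (plain_heads sp).
have uP := cov_uniqP cv PPs.
case: (boolP (unused Ps Cs z)) => un.
  apply: (@leq_trans 1) => //; apply/card_le1_eqP => x x'; rewrite !inE.
  move=> /andP [i1 l1] /andP [i2 l2].
  have [y st] := labz_unused sp i1 un l1; have [y' st'] := labz_unused sp i2 un l2.
  by case: (step_predU uP st st').
have : #|nbr e z| = 3 by apply: deg3.
rewrite (cardsD1 s) inE e_sym sz => -[<-]; apply: subset_leq_card.
apply/subsetP => x; rewrite !inE => /andP [i1 l1]; rewrite (labz_used sp i1 un l1) andbT.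
by have [_ _ _ _] := innerP i1; apply: contra => /eqP ->.
Qed.

Lemma labz_own_card s z : s \in plain -> e s z ->
  #|[set x | [&& inner x, labz s z x & pof x == pof s]]| <= 1.
Proof.
move=> sp sz; have [PPs bs sE sX] := headP (plain_heads sp).
have uP := cov_uniqP cv PPs.
apply/card_le1_eqP => x x'; rewrite !inE => /and3P [i1 l1 p1] /and3P [i2 l2 p2].
case: (boolP (unused Ps Cs z)) => un.
  have [y st] := labz_unused sp i1 un l1; have [y' st'] := labz_unused sp i2 un l2.
  by case: (step_predU uP st st').
move: l1 l2; rewrite /labz (negbTE un) p1 p2 !andbF !orbF /= => /andP [_ /existsP [b st]].
by move=> /andP [_ /existsP [b' st']]; case: (step_midU uP st st').
Qed.

(** The neighbour of [s] on its own path gives no label, as the only vertex before it is [s]. *)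
Lemma plain_tokens s : s \in plain -> 1 < size (pof s) -> exists z1 z2,
  [/\ e s z1, e s z2 & forall x, inner x -> LAB s x -> labz s z1 x \/ labz s z2 x].
Proof.
move=> sp sz; have [PPs bs sE sX] := headP (plain_heads sp).
have uP := cov_uniqP cv PPs; have xP := cov_xpath cv PPs.
have [y1 [b1 st1]] := beg_second xP bs sz.
have [sy _] := step_adj xP st1; have [_ yP _] := step_mem st1.
have : #|nbr e s| == 3 by rewrite deg3.
rewrite (cardsD1 y1) inE sy => /cards2P [z1 [z2 [_ zE]]].
have mz z : (z \in [set z1; z2]) = (z != y1) && e s z by rewrite -zE !inE.
exists z1, z2; split.
- by have := mz z1; rewrite !inE eqxx /= => /esym /andP [].
- by have := mz z2; rewrite !inE eqxx orbT /= => /esym /andP [].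
move=> x ix' /(LAB_plain sp) [z lz]; have /andP [sz' lz'] := lz.
have := mz z; rewrite sz' andbT !inE.
case: (eqVneq z y1) => [zy|_ /orP [] /eqP <-]; [|by left|by right].
move=> _; exfalso; rewrite {}zy {z lz sz'} in lz'.
have [xX QPs xQ uQ nE] := innerP ix'.
case/or3P: lz' => [/andP [/existsP [b lk] ps]|/existsP [b st]|/andP [un _]].
- have [_ yQ _] := link3_mem lk.
  by rewrite (cov_PP cv QPs PPs yQ yP) eqxx in ps.
- by have [xs _] := step_midU uP st st1; rewrite xs sE in nE.
- by have := unused_flat un; rewrite (mem_flat PPs yP).
Qed.

Definition dead s u := [forall x, e u x ==> LAB s x].

Lemma deadP s u x : dead s u -> e u x -> LAB s x.
Proof. by move=> /forallP /(_ x) /implyP. Qed.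

(* The neighbours of [u] and [u'] would be six vertices labelled by [s], but each of
   the two neighbours of [s] off its path gives at most two labels. *)
Lemma dead_unique s u u' : s \in plain -> 1 < size (pof s) -> ntype u -> ntype u' ->
  dead s u -> dead s u' -> u = u'.
Proof.
move=> sp sz nu nu' du du'; apply/eqP/negPn/negP => uu.
have [z1 [z2 [sz1 sz2 tok]]] := plain_tokens sp sz.
have un : unused Ps Cs u by case/andP: nu.
have un' : unused Ps Cs u' by case/andP: nu'.
have sub : nbr e u :|: nbr e u' \subset
    [set x | inner x && labz s z1 x] :|: [set x | inner x && labz s z2 x].
  apply/subsetP => x xu; have [i l] : inner x /\ LAB s x.
    move: xu; rewrite !inE => /orP [] h.
      by split; [exact: ntypeP nu h|exact: deadP du h].
    by split; [exact: ntypeP nu' h|exact: deadP du' h].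
  by rewrite !inE i; case: (tok x i l) => ->; rewrite ?orbT.
have := subset_leq_card sub; rewrite !cardsU !deg3.
have -> : nbr e u :&: nbr e u' = set0.
  apply/setP => x; rewrite !inE; apply/negP => /andP [ux ux'].
  by case/eqP: uu; apply: (inner_unusedU (ntypeP nu ux)) => //; rewrite e_sym.
rewrite cards0; have := labz_card sp sz1; have := labz_card sp sz2; clear; lia.
Qed.

(** A bent head labels at most two vertices, too few for the neighbours of [u]. From a one-vertex
    path all three labels would pass through the same [z], by [single_two_feet], and with [s] this
    gives [z] four neighbours. On its own path a plain [s] labels at most one vertex through each of
    two neighbours, so some label lies elsewhere. *)
Lemma dead_plain s u : s \in heads -> ntype u -> dead s u ->
  [/\ s \in plain, 1 < size (pof s) & exists2 x, e u x & pof x != pof s].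
Proof.
move=> hs nu du; have [PPs bs sE sX] := headP hs.
have un : unused Ps Cs u by case/andP: nu.
have d3 := deg3 u.
have sp : s \in plain.
  rewrite inE hs andbT; apply/negP => sb.
  have /and5P [/andP [uns su] ux ii ps _] := ixP sb.
  have [a [y [y' [b [st1 st2 yy]]]]] := inner_mid ii.
  have sub : nbr e u \subset [set a; b].
    apply/subsetP => x; rewrite !inE => xu.
    have := deadP du xu; rewrite /LAB sb => /existsP [t lk].
    have [_ QPs _ uQ _] := innerP (ntypeP nu xu).
    have [_ _ iQ] := link3_mem lk; rewrite -(pofE QPs iQ) in lk uQ.
    case/orP: lk => st.
      by have [-> _] := step_predU uQ st st1; rewrite eqxx.
    by have [_ ->] := step_succU uQ st st2; rewrite eqxx orbT.
  by have := subset_leq_card sub; rewrite d3 cards2; case: (a != b).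
have sz : 1 < size (pof s).
  rewrite ltnNge; apply/negP => sz; have pE := size1_beg bs sz.
  have foot x : e u x -> exists z, [/\ e s z, pof x != pof s & exists b, link3 (pof x) x z b].
    move=> ux; have [z /andP [sz']] := LAB_plain sp (deadP du ux).
    have ns a y b : ~~ step (pof s) a y b.
      by apply/negP => /step_size; rewrite pE.
    case/or3P => [/andP [/existsP [b lk] ps]|/existsP [b st]|/andP [_ /existsP [y st]]].
    - by exists z; split => //; exists b.
    - by rewrite (negbTE (ns _ _ _)) in st.
    - by rewrite (negbTE (ns _ _ _)) in st.
  have two x x' z z' : e u x -> e u x' -> x != x' -> e s z -> e s z' ->
      pof x != pof s -> pof x' != pof s ->
      (exists b, link3 (pof x) x z b) -> (exists b, link3 (pof x') x' z' b) -> z = z'.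
    move=> ux ux' xx sz1 sz2 ps ps' [b lk] [b' lk'].
    have [_ QPs _ _ _] := innerP (ntypeP nu ux).
    have [_ QPs' _ _ _] := innerP (ntypeP nu ux').
    apply/eqP/negPn/negP => zz.
    rewrite pE in PPs ps ps'; rewrite link3C in lk; rewrite link3C in lk'.
    apply: (single_two_feet tg PPs QPs ps lk QPs' ps' lk' _ _ sz1 sz2 zz un _ _ xx).
    - by rewrite -(eX sz1).
    - by rewrite -(eX sz2).
    - by rewrite e_sym.
    - by rewrite e_sym.
  have [x1 ux1] : exists x, e u x.
    by have /card_gt0P [x] : 0 < #|nbr e u|; rewrite ?d3 // inE; exists x.
  have [z [sz1 ps1 lk1]] := foot _ ux1.
  have sub : s |: nbr e u \subset nbr e z.
    apply/subsetP => x; rewrite !inE => /orP [/eqP ->|ux]; first by rewrite e_sym.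
    have [_ QPs _ _ _] := innerP (ntypeP nu ux).
    suff [b lk] : exists b, link3 (pof x) x z b.
      by have [h _] := link3_adj (cov_xpath cv QPs) lk; rewrite e_sym.
    case: (eqVneq x x1) => [->|xx] //.
    have [z' [sz' ps' lk']] := foot _ ux.
    by rewrite (two x1 x z z') // eq_sym.
  have := subset_leq_card sub; rewrite cardsU1 !deg3 inE.
  case: (boolP (e u s)) => // /(ntypeP nu) /innerP [_ _ _ _].
  by rewrite sE.
split => //.
case: (boolP [exists x, e u x && (pof x != pof s)]) => [/existsP [x /andP [? ?]]|nx'].
  by exists x.
exfalso.
have [z1 [z2 [sz1 sz2 tok]]] := plain_tokens sp sz.
have sub : nbr e u \subset [set x | [&& inner x, labz s z1 x & pof x == pof s]] :|:
   [set x | [&& inner x, labz s z2 x & pof x == pof s]].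
  apply/subsetP => x; rewrite !inE => ux; have i := ntypeP nu ux.
  move: nx'; rewrite negb_exists => /forallP /(_ x); rewrite ux negbK /= => ->.
  by rewrite i !andbT; case: (tok x i (deadP du ux)) => ->; rewrite ?orbT.
have := subset_leq_card sub; rewrite cardsU d3.
have := labz_own_card sp sz1; have := labz_own_card sp sz2; clear; lia.
Qed.

(** The stretch [y], [z], [u] takes the place of [y] in [Q], and the one-vertex path disappears. *)
Lemma insert_single z Q L y R a x u : [:: z] \in Ps -> Q \in Ps -> Q != [:: z] ->
  Q = L ++ y :: R -> y \notin X -> fin a L -> beg x R -> e z y -> unused Ps Cs u ->
  e z u -> e x u -> False.
Proof.
move=> zPs QPs Qz QE yX fL bR zy un zu xu; have [_ sp sq] := tg.
have QPr := mem_rm_neq QPs Qz.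
have sP := size_rm zPs; have sQ := size_rm QPr.
have cP t := count_rm t zPs; have cQ t := count_rm t QPr.
have xQ := cov_xpath cv QPs; rewrite QE in xQ.
have [a' [b [[xL xR] fa _ ay yb]]] := xpath_split xQ yX.
have zX : z \in X by rewrite (eX zy).
have xN : xpath (L ++ y :: z :: u :: R).
  apply: (@xpath_link a' y z) => //; rewrite ?beg_cons // 1?e_sym //.
  apply: (@xpath_link z u x [:: z]) => //; first by rewrite /= zX.
    exact: beg_cons.
  by rewrite e_sym.
have cv' : cov ((L ++ y :: z :: u :: R) :: rm Q (rm [:: z] Ps)) Cs.
  apply: (cov_move (us := [:: u]) (ys := [::]) cv) => //.
  - by rewrite /= xN; do 2!apply: xpath_all_rem; exact: cov_allP cv.
  - exact: cov_allC cv.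
  - by rewrite /= un.
  - by move=> t; rewrite /cells !countE cP cQ QE ?countE; counts.
by move: (p0_min cv') sp sq sP sQ; clear => /=; lia.
Qed.

Definition cycint u := has (fun C => nbr e u \subset C) Cs.

(** * The candidates for a Λ-independent set *)

(** Where every neighbour of [u] is labelled, the pick is at least taken off the path of the
    labelling head: on that path it could spoil the uniqueness in [up_inner_unique]. *)
Definition pick_spec u w := [/\ inner w, e u w,
  ntype u -> (forall s, s \in heads -> ~~ LAB s w) \/
    exists s, [/\ s \in plain, 1 < size (pof s), dead s u & pof w != pof s] &
  forall s, s \in plain -> 1 < size (pof s) -> e s u -> w = G s u].

Context (pk : V -> V).
Context (pkP : forall u, unused Ps Cs u -> ~~ cycint u -> pick_spec u (pk u)).

Definition U0 := [set u | [&& unused Ps Cs u, ~~ cycint u & u \notin [set iu s | s in bent]]].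
Definition VC (C : seq V) := [set v | inner v && has (fun y => (y \notin X) && e y v) C].
Definition Vc := [set v | has (fun C => (1 < #|VC C|) && (v \in VC C)) Cs].
Definition restin := (pk @: U0) :|: Vc.
Definition rest := plain :|: restin.

Lemma U0P u : u \in U0 -> [/\ unused Ps Cs u, pick_spec u (pk u) &
  forall s, s \in bent -> u != iu s].
Proof.
rewrite inE => /and3P [un nc ni]; split => //; first exact: pkP.
by move=> s sb; apply: contra ni => /eqP ->; rewrite imset_f.
Qed.

Lemma cyc_flat C y : C \in Cs -> y \in C -> y \notin flatten Ps.
Proof.
move=> CCs yC; apply/negP => /pofP [QPs yQ]; exact: (cov_PC cv QPs CCs yQ yC).
Qed.

Lemma cyc_unused C y : C \in Cs -> y \in C -> ~~ unused Ps Cs y.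
Proof. by move=> CCs yC; rewrite /unused (memCs_cells _ CCs yC) andbF. Qed.

Lemma VcP w : w \in Vc -> exists C y,
  [/\ C \in Cs, 1 < #|VC C|, inner w, y \in C & (y \notin X) && e y w].
Proof.
rewrite inE => /hasP [C CCs /andP [sz]]; rewrite inE => /andP [iw /hasP [y yC yw]].
by exists C, y.
Qed.

Lemma restin_inner w : w \in restin -> inner w.
Proof.
by case/setUP => [/imsetP [u /U0P [_ [iw _ _ _] _] ->]|/VcP [C [y []]]].
Qed.

Lemma restin_off w : w \in restin -> exists2 z, z \notin flatten Ps & e w z /\
  ((exists2 u, u \in U0 & w = pk u /\ z = u) \/
   (exists2 C, C \in Cs & [/\ z \in C, z \notin X & 1 < #|VC C|])).
Proof.
case/setUP => [/imsetP [u uU wE]|/VcP [C [y [CCs sz iw yC /andP [yX yw]]]]].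
  have [un [iw uw _ _] _] := U0P uU; exists u; first exact: unused_flat.
  by split; [rewrite wE e_sym | left; exists u].
exists y; first exact: cyc_flat yC.
by split; [rewrite e_sym | right; exists C].
Qed.

Lemma restin_nbr w z : w \in restin -> e w z ->
  [\/ exists2 u, u \in U0 & w = pk u /\ z = u,
      exists2 C, C \in Cs & [/\ z \in C, z \notin X & 1 < #|VC C|] |
      exists b, link3 (pof w) w z b].
Proof.
move=> wr wz; have iw := restin_inner wr.
have [o oflat [wo off]] := restin_off wr.
case: (eqVneq z o) => [->|zo]; last by constructor 3; exact: inner_nbr zo.
by case: off; [constructor 1 | constructor 2].
Qed.

(* The two ways in which a chosen vertex [w] can be labelled: as the representative
   of an unused vertex with all its neighbours labelled by [s], or by a one-vertex
   path [s] adjacent to the unused vertex that [w] represents. *)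
Definition dd s w := exists u, [/\ w = pk u, u \in U0, ntype u &
  [/\ s \in plain, 1 < size (pof s), dead s u & pof w != pof s]].
Definition ud s w := exists u, [/\ w = pk u, u \in U0, e s u, s \in plain & pof s = [:: s]].

Lemma plainI s : s \in heads -> s \notin bent -> s \in plain.
Proof. by move=> hs sb; rewrite inE sb. Qed.

Lemma LABI s z w : s \in plain -> labz s z w -> LAB s w.
Proof. by rewrite inE /LAB => /andP [/negbTE -> _] lz; apply/existsP; exists z. Qed.

Lemma guide_free s u : s \in plain -> 1 < size (pof s) -> unused Ps Cs u -> e s u ->
  ~~ LAB s (G s u).
Proof.
move=> sp sz un su; have [/(_ u un su) [ig ug pg c1] c2] := GP sp sz.
apply/negP => /(LAB_plain sp) [z /andP [sz']].
case/or3P => [/andP [_]|/existsP [b st]|/andP [un' /existsP [y st]]].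
- by rewrite pg eqxx.
- by have := c1 _ _ st; rewrite sz'.
- by have := c2 z u y un' un sz' su; rewrite st.
Qed.

(** A labelled vertex next to a cycle could become an end adjacent to that cycle. For the pick of
    [u], [pick_spec] decides if all neighbours of [u] are inner. Otherwise some neighbour [f] is not
    inner; [lab_free] and [lab_free_cyc] force [f = s], and then [insert_end] excludes a bent [s],
    and [guide_free] a plain one on a longer path. *)
Lemma rest_lab s w : s \in heads -> w \in restin -> LAB s w -> dd s w \/ ud s w.
Proof.
move=> hs wr lb; have iw := restin_inner wr.
have [PPs bs sE sX] := headP hs.
have [h [y [xh lb']]] := LAB_lab hs iw lb.
case/setUP: wr => [/imsetP [u uU wE]|/VcP [C [y' [CCs sz _ yC /andP [yX yw]]]]]; last first.
  by case: (lab_cyc_adj tg PPs bs lb' CCs yC); rewrite e_sym.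
have [un [_ uw nt gd] nb] := U0P uU; rewrite -wE in uw nt gd.
have wu : e w u by rewrite e_sym.
case: (boolP (ntype u)) => nu.
  case: (nt nu) => [/(_ s hs)|]; first by rewrite lb.
  case=> s' [sp' sz' du ps']; left; exists u; split => //.
  suff -> : s = s' by [].
  have [x ux xw] : exists2 x, e u x & w != x.
    have : #|nbr e u| = 3 by []; rewrite (cardsD1 w) inE uw add1n => -[d2].
    have /card_gt0P [x] : 0 < #|nbr e u :\ w| by rewrite d2.
    by rewrite !inE => /andP [xw ux]; exists x; rewrite // eq_sym.
  have hs' := plain_heads sp'.
  have [h1 [y1 [xh1 lb1]]] := LAB_lab hs' (ntypeP nu ux) (deadP du ux).
  exact: (ntype_lab_head nu hs lb' hs' lb1 uw ux xw).
right.
have [f uf nf] : exists2 f, e u f & ~~ inner f.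
  move: nu; rewrite /ntype un /= => /forallPn [f]; rewrite negb_imply => /andP [? ?].
  by exists f.
have fu : e f u by rewrite e_sym.
have fX := unused_X un uf.
have sf : f = s.
  case: (X_cases fX) => [|fE|[C CCs fC]]; first by rewrite (negbTE nf).
    apply/eqP/negPn/negP => fs.
    apply: (lab_free tg PPs bs lb' un wu fu fE fs).
    by apply: contraNneq nf => ->.
  by case: (lab_free_cyc tg PPs bs lb' un wu fu CCs fC fX).
rewrite {}sf {f nf fX uf} in fu.
case: (boolP (s \in bent)) => sb.
  exfalso; have /and5P [/andP [uni sui] ixu ii ps _] := ixP sb.
  move: lb; rewrite /LAB sb => /existsP [t lk].
  have [_ QPs _ uQ _] := innerP iw.
  have [wQ tQ iQ] := link3_mem lk.
  have tX : t \notin X by have [h1 _] := link3_adj (cov_xpath cv QPs) lk; rewrite -(eX h1); case: (innerP iw).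
  have [Q' [L [R [QQ QE fL bR]]]] := link3E lk.
  rewrite (pofE QPs iQ) in ps.
  by apply: (insert_end op PPs QPs ps bs QQ QE tX fL bR (nb s sb) un uni).
have sp := plainI hs sb; exists u; split => //.
apply: (size1_beg bs); rewrite leqNgt; apply/negP => sz.
by have := guide_free sp sz un fu; rewrite -(gd s sp sz fu) lb.
Qed.

Lemma ix_lab s t : s \in heads -> t \in bent -> ~~ LAB s (ix t).
Proof.
move=> hs tb; apply/negP => lb; have [PPs bs sE sX] := headP hs.
have /and5P [/andP [un tu] ux ii ps _] := ixP tb.
have [PPs' bt tE tX] := headP (bent_heads tb).
case: (eqVneq t s) => [ts|ts].
  move: lb; rewrite /LAB -ts tb => /existsP [y lk].
  have [_ QPs _ uQ _] := innerP ii.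
  by have := link3_neq uQ lk; rewrite eqxx.
have [h [y [xh lb']]] := LAB_lab hs ii lb.
apply: (lab_free tg PPs bs lb' un _ tu tE ts); first by rewrite e_sym.
by apply: contraTneq tE => ->; case: (innerP ii).
Qed.

(** * Conflicts *)

Definition conf w w' := [exists z, e w z && e w' z].

Lemma cyc_nbrs C z : C \in Cs -> z \in C -> z \notin X -> exists a b,
  [/\ a \in C, b \in C, a != b, e z a & e z b].
Proof.
move=> CCs zC zX; have xC := cov_xcyc cv CCs.
have [p [a [b [pe xp [ba fb] za bz]]]] := cyc_openY xC zC zX.
exists a, b; split => //; last by rewrite e_sym.
- by rewrite (perm_mem pe) inE beg_mem ?orbT.
- by rewrite (perm_mem pe) inE fin_mem ?orbT.
- have := cov_uniqC cv CCs; rewrite (perm_uniq pe) /= => /andP [_ up].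
  apply: contraTneq xC => ab; rewrite /xcyc (perm_size pe) -ab in fb *.
  by rewrite (beg_fin_uniq up ba fb) andbF.
Qed.

Lemma cyc_out C z v w : C \in Cs -> z \in C -> z \notin X -> e z v -> e z w ->
  v \notin C -> w \notin C -> v = w.
Proof.
move=> CCs zC zX zv zw vC wC; have [a [b [aC bC ab za zb]]] := cyc_nbrs CCs zC zX.
have ne t r : t \in C -> r \notin C -> t != r by move=> tC; apply: contraNneq => <-.
have := deg_eq za zb zv ab (ne _ _ aC vC) (ne _ _ bC vC) zw.
by rewrite ![w == _]eq_sym (negbTE (ne _ _ aC wC)) (negbTE (ne _ _ bC wC)) => /eqP.
Qed.

Lemma inner_cyc w C : inner w -> C \in Cs -> w \notin C.
Proof.
by move=> iw CCs; have [_ QPs wQ _ _] := innerP iw; apply: contraTN (mem_flat QPs wQ) => /(cyc_flat CCs).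
Qed.

(** The one neighbour that [w] has off the paths is adjacent to no other element of [restin], so the
    common neighbour lies on a path. *)
Lemma conf_inner w w' : w \in restin -> w' \in restin -> w != w' -> conf w w' ->
  exists y, link3 (pof w) w' y w.
Proof.
move=> wr wr' ww /existsP [z /andP [wz wz']].
have iw := restin_inner wr; have iw' := restin_inner wr'.
have [_ QPs wQ uQ _] := innerP iw; have [_ QPs' wQ' _ _] := innerP iw'.
have fl b v : inner v -> link3 (pof v) v z b -> z \in flatten Ps.
  by move=> /innerP [_ h _ _ _] /link3_mem [_ zQ _]; exact: mem_flat zQ.
have uf u : u \in U0 -> u \notin flatten Ps by move=> /U0P [/unused_flat].
have ucf u C : u \in U0 -> C \in Cs -> u \notin C.
  by move=> /U0P [un _ _] CCs; apply: contraTN un; exact: cyc_unused.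
case: (restin_nbr wr wz) => [[u uU [wE zE]]|[C CCs [zC zX _]]|[b lk]];
case: (restin_nbr wr' wz') => [[u' uU' [wE' zE']]|[C' CCs' [zC' _ _]]|[b' lk']].
- by rewrite wE wE' -zE -zE' eqxx in ww.
- by have := ucf u C' uU CCs'; rewrite -zE zC'.
- by have := uf _ uU; rewrite -zE (fl _ _ iw' lk').
- by have := ucf u' C uU' CCs; rewrite -zE' zC.
- have := cyc_out CCs zC zX _ _ (inner_cyc iw CCs) (inner_cyc iw' CCs).
  by rewrite ![e z _]e_sym => /(_ wz wz') wE; rewrite wE eqxx in ww.
- by have := cyc_flat CCs zC; rewrite (fl _ _ iw' lk').
- by have := uf _ uU'; rewrite -zE' (fl _ _ iw lk).
- by have := cyc_flat CCs' zC'; rewrite (fl _ _ iw lk).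
- have [_ zQ _] := link3_mem lk; have [_ zQ' _] := link3_mem lk'.
  rewrite -(cov_PP cv QPs QPs' zQ zQ') in lk'.
  case: (link3_midU uQ lk lk') => -[E _]; first by rewrite E eqxx in ww.
  by exists z; rewrite E link3C.
Qed.

Lemma conf_head w s : w \in restin -> s \in heads -> conf w s ->
  (exists u, [/\ u \in U0, e s u & w = pk u]) \/
  (exists y b, e s y /\ link3 (pof w) w y b).
Proof.
move=> wr hs /existsP [z /andP [wz sz]].
case: (restin_nbr wr wz) => [[u uU [wE zE]]|[C CCs [zC zX _]]|[b lk]].
-  by left; exists u; split => //; rewrite -zE.
- have [PPs bs _ _] := headP hs.
  by case: (@end_cyc_adj Ps Cs (pof s) C s z tg PPs CCs) => //; rewrite /isend bs.
- by right; exists z, b.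
Qed.

(** The common neighbour [z] lies on a path. Its two neighbours there and two further heads would
    make four, so one of the heads is next to it on that path. *)
Lemma conf_heads s s' : s \in heads -> s' \in heads -> s != s' -> conf s s' ->
  exists z b, (e s z /\ step (pof s') s' z b) \/ (e s' z /\ step (pof s) s z b).
Proof.
move=> hs hs' ss /existsP [z /andP [sz sz']].
have [PPs bs sE sX] := headP hs; have [PPs' bs' sE' sX'] := headP hs'.
have zX : z \notin X by rewrite -(eX sz).
case: (boolP (z \in cells Ps Cs)) => zc; last first.
  by case: (isE_share tg sE sE' ss _ sz sz'); rewrite /unused zX.
move: zc; rewrite mem_cat => /orP [/pofP [QPs zQ]|/flattenP [C CCs zC]]; last first.
  by case: (@end_cyc_adj Ps Cs (pof s) C s z tg PPs CCs) => //; rewrite /isend bs.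
have [a [b st]] := pathY QPs zQ zX; have uQ := cov_uniqP cv QPs.
have [az zb] := step_adj (cov_xpath cv QPs) st.
have [aQ _ bQ] := step_mem st.
have nb t : t \in heads -> t == b = false.
  move=> ht; apply/negP => /eqP tb; have [_ bt _ _] := headP ht.
  rewrite tb (pofE QPs bQ) in bt.
  by have [_ n] := step_nx st; have := beg_nx z uQ bt; rewrite n.
have pa : pof a = pof z := pofE QPs aQ.
exists z, b; case: (eqVneq s a) => [sa|sa]; first by right; rewrite sa pa.
case: (eqVneq s' a) => [sa'|sa']; first by left; rewrite sa' pa.
have za : e z a by rewrite e_sym.
have zs : e z s by rewrite e_sym.
have zs' : e z s' by rewrite e_sym.
have := deg_eq za zb zs (step_neq uQ st) _ _ zs'.
by rewrite ![_ == s]eq_sym sa (nb _ hs) (nb _ hs') (negbTE sa') (negbTE ss) => /(_ isT isT).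
Qed.

(* Longer paths come first, and within a path the order is that of the path. *)
Definition rank w := (#|V| - size (pof w)) * #|V|.+1 + index w (pof w).

Lemma rank_pof w w' : pof w = pof w' -> (rank w <= rank w') = (index w (pof w) <= index w' (pof w)).
Proof. by move=> ww; rewrite /rank -ww leq_add2l. Qed.

Lemma size_pof w : w \in flatten Ps -> size (pof w) <= #|V|.
Proof.
by case/pofP => /(cov_uniqP cv) /card_uniqP <- _; apply: max_card.
Qed.

Lemma rank_size w w' : w \in flatten Ps -> w' \in flatten Ps ->
  size (pof w) < size (pof w') -> rank w <= rank w' = false.
Proof.
move=> wf wf' ss; have := size_pof wf; have := size_pof wf'.
have := index_size w' (pof w'); rewrite /rank.
move: (size _) (size _) (index _ _) (index _ _) #|V| ss; clear => a b i j N; nia.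
Qed.

Definition up w w' := [/\ w' \in rest, w' != w, conf w w' & rank w' <= rank w].

Lemma inner_flat w : inner w -> w \in flatten Ps.
Proof. by case/and3P. Qed.
Lemma head_flat s : s \in heads -> s \in flatten Ps.
Proof. by rewrite inE => /andP []. Qed.

Lemma inner_size w : inner w -> 1 < size (pof w).
Proof. by case/inner_mid => [a [y [y' [b [/step_size]]]]]; lia. Qed.

Lemma head_size s : s \in heads -> 1 < size (pof s) \/ pof s = [:: s].
Proof.
case/headP => _ bs _ _; case: (leqP (size (pof s)) 1) => h; last by left.
by right; apply: size1_beg.
Qed.

(** A head that reaches [w] from another path lies on a shorter one and comes later, so an earlier
    conflict stays on the path of [w]. *)
Lemma up_inner w w' : w \in restin -> up w w' ->
  (exists y, step (pof w) w' y w) \/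
  [/\ w' \in plain, pof w' = pof w, 1 < size (pof w') &
    (exists y b, [/\ e w' y, step (pof w) b y w & b != w']) \/
    exists u, [/\ unused Ps Cs u, e w' u & w = G w' u]].
Proof.
move=> wr [wr' ww cf rk]; have iw := restin_inner wr; have [wX QPs wQ uQ wE] := innerP iw.
case/setUP: wr' => [sp|wr'].
  have hs := plain_heads sp; have [PPs bs sE sX] := headP hs.
  case: (conf_head wr hs cf) => [[u [uU su wE']]|[y [b [sy lk]]]].
    have [un [_ uw nt gd] nb] := U0P uU; rewrite -wE' in gd.
    case: (head_size hs) => sz; last first.
      have := rank_size (head_flat hs) (inner_flat iw).
      by rewrite rk sz inner_size // => /(_ isT).
    have wG := gd _ sp sz su.
    have [/(_ u un su) [_ _ pg _] _] := GP sp sz.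
    by right; split => //; [rewrite wG | right; exists u].
  have [wy yb] := link3_adj (cov_xpath cv QPs) lk.
  case: (eqVneq (pof w') (pof w)) => pw; last first.
    have lb : lab Ps Cs (pof w') w' y w y b.
      split; rewrite // /usable ?eqxx //; first by rewrite -(eX wy).
      by left; exists (pof w); split; rewrite // 1?eq_sym // link3C.
    have yQ : y \in pof w by case: (link3_mem lk).
    have := lab_size op PPs bs lb QPs _ yQ; rewrite eq_sym => /(_ pw) sz.
    by have := rank_size (head_flat hs) (inner_flat iw) sz; rewrite rk.
  have sz : 1 < size (pof w') by rewrite pw inner_size.
  case/orP: lk => st; last first.
    case: (eqVneq b w') => [bE|bw]; first by left; exists y; rewrite -bE.
    by right; split => //; left; exists y, b.
  (* Here [y] follows [w], so the head of the path labels [w], which [rest_lab] excludes. *)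
  have lz : labz w' y w by rewrite /labz sy; apply/or3P; constructor 2; apply/existsP; exists b; rewrite pw.
  case: (rest_lab hs wr (LABI sp lz)) => [[u [_ _ _ [_ _ _]]]|[u [_ _ _ _ p1]]].
    by rewrite pw eqxx.
  by rewrite p1 in sz.
left; rewrite eq_sym in ww; have [y lk] := conf_inner wr wr' ww cf.
exists y; case/orP: lk => // st; have [_ _ wQ'] := step_mem st.
have pw := pofE QPs wQ'.
by move: rk; rewrite rank_pof // pw (step_index uQ st); clear; lia.
Qed.

(** The critical pair is a candidate [v] two places before [w] and the head [s] of the path.
    Whatever brings [s] into conflict with [w] makes [s] label [v], against [rest_lab]. *)
Lemma up_inner_unique w w1 w2 : w \in restin -> up w w1 -> up w w2 -> w1 = w2.
Proof.
move=> wr; have iw := restin_inner wr; have [_ _ _ uQ _] := innerP iw.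
have mixed s v y : s \in plain -> pof s = pof w -> 1 < size (pof s) ->
    v \in rest -> step (pof w) v y w ->
    (exists y b, [/\ e s y, step (pof w) b y w & b != s]) \/
    (exists u, [/\ unused Ps Cs u, e s u & w = G s u]) -> v = s.
  move=> sp ps sz vr st own; have hs := plain_heads sp.
  have [vQ _ _] := step_mem st; have [_ QPs _ _ _] := innerP iw.
  have pv := pofE QPs vQ.
  case/setUP: vr => [vp|vr]; first by apply: (head_inj (plain_heads vp) hs); rewrite pv.
  have lb : LAB s v.
    case: own => [[y' [b [sy st' bs]]]|[u [un su wG]]].
      have [_ yE] := step_predU uQ st' st; rewrite yE in sy.
      apply: (LABI sp (z := y)); rewrite /labz sy; apply/or3P; constructor 2.
      by apply/existsP; exists w; rewrite ps.
    apply: (LABI sp (z := u)); rewrite /labz su un; apply/or3P; constructor 3.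
    by apply/existsP; exists y; rewrite ps -wG.
  case: (rest_lab hs vr lb) => [[u [_ _ _ [_ _ _]]]|[u [_ _ _ _ p1]]].
    by rewrite pv ps eqxx.
  by rewrite p1 in sz.
move=> u1 u2; have [r1 _ _ _] := u1; have [r2 _ _ _] := u2.
case: (up_inner wr u1) => [[y1 st1]|[sp1 p1 sz1 o1]];
case: (up_inner wr u2) => [[y2 st2]|[sp2 p2 sz2 o2]].
- by case: (step_predU uQ st1 st2).
- exact: (mixed w2 w1 y1).
- by apply/esym; apply: (mixed w1 w2 y2).
- by apply: (head_inj (plain_heads sp1) (plain_heads sp2)); rewrite p1.
Qed.

Definition single_link s w s1 y x h :=
  [/\ beg s1 (pof w), step (pof w) s1 y x, e s h, e h x & usable Ps Cs y h] /\
  (h = y /\ w = s1 \/ [/\ unused Ps Cs h, w = pk h & w = x]).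

(** By [lopsided] and [plain_far], only a one-vertex path reaches the beginning of another path. On
    a longer path, an earlier conflict of the head is with a labelled pick. *)
Lemma up_head s w : s \in plain -> up s w ->
  (1 < size (pof s) /\ dd s w) \/
  [/\ pof s = [:: s], pof w \in Ps, pof w != pof s &
      exists s1 y x h, single_link s w s1 y x h].
Proof.
move=> sp [wr ws cf rk]; have hs := plain_heads sp; have [PPs bs sE sX] := headP hs.
case/setUP: wr => [wp|wr].
  have hw := plain_heads wp; have [QPs bw wE wX] := headP hw.
  rewrite eq_sym in ws.
  have pw : pof w != pof s by apply: contra ws => /eqP /(head_inj hw hs) ->.
  have [z [b [[sz st]|[wz st]]]] := conf_heads hs hw ws cf; last first.
    have [sz zb] := step_adj (cov_xpath cv PPs) st.
    have lb : lab Ps Cs (pof w) w z s z b.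
      split; rewrite // /usable ?eqxx //; first by rewrite -(eX sz).
      by left; exists (pof s); split; rewrite // 1?eq_sym // /link3 st orbT.
    have zP : z \in pof s by case: (step_mem st).
    rewrite eq_sym in pw; have ss := lab_size op QPs bw lb PPs pw zP.
    by have := rank_size (head_flat hw) (head_flat hs) ss; rewrite rk.
  have [wz zb] := step_adj (cov_xpath cv QPs) st.
  have uQ := cov_uniqP cv QPs.
  have us : usable Ps Cs z z by rewrite /usable eqxx.
  have zX : z \notin X by rewrite -(eX sz).
  have [R [RE fR _]] := step_beg uQ bw st.
  have := lopsided op PPs QPs pw bs (or_intror erefl) RE zX fR (beg_cons _ _) sz zb us.
  move=> /(size1_beg bs) pE; right; split => //.
  by exists w, z, b, z; split => //; left.
have iw := restin_inner wr; have [_ QPs wQ uQ wE] := innerP iw.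
have own : pof s != pof w.
  apply: contraNneq wE => ps; move: rk; rewrite (rank_pof (esym ps)).
  rewrite ps in bs; rewrite (beg_index bs) leqn0 => /eqP i0; apply: (isEP QPs).
  by rewrite /isend index_beg.
rewrite eq_sym in own.
have single u : u \in U0 -> e s u -> w = pk u -> pof s = [:: s] ->
  exists s1 y x h, single_link s w s1 y x h.
  move=> uU su wE' pE; have [un [_ uw _ _] _] := U0P uU; rewrite -wE' in uw.
  have [sx _] := plain_far sp un su uw iw own.
  have [a [y [_ [_ [st _ _]]]]] := inner_mid iw.
  have [aQ _ _] := step_mem st.
  exists a, y, w, u; split; last by right.
  split => //; last by rewrite /usable un orbT.
  apply: (index_beg aQ).
  by have := step_index uQ st; rewrite (eqP sx) => -[].
have fin_ud : ud s w -> [/\ pof s = [:: s], pof w \in Ps, pof w != pof s &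
      exists s1 y x h, single_link s w s1 y x h].
  by case=> u [wE' uU su _ pE]; split => //; apply: (single u).
rewrite /conf in cf; have {}cf : conf w s.
  by case/existsP: cf => z /andP [? ?]; apply/existsP; exists z; apply/andP.
case: (conf_head wr hs cf) => [[u [uU su wE']]|[y [b [sy lk]]]].
  case: (head_size hs) => sz; last by right; apply: fin_ud; exists u.
  have [un [_ uw nt gd] nb] := U0P uU; rewrite -wE' in gd.
  have wG := gd _ sp sz su.
  have [/(_ u un su) [_ _ pg _] _] := GP sp sz.
  by rewrite wG pg eqxx in own.
have lz : labz s y w.
  by rewrite /labz sy; apply/or3P; constructor 1; rewrite own andbT; apply/existsP; exists b.
case: (rest_lab hs wr (LABI sp lz)) => [d|u]; last by right; apply: fin_ud.
by left; split => //; case: d => u [_ _ _ []].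
Qed.

Lemma up_head_unique s w1 w2 : s \in plain -> up s w1 -> up s w2 -> w1 = w2.
Proof.
move=> sp /(up_head sp) H1 /(up_head sp) H2; have hs := plain_heads sp.
have [PPs _ sE _] := headP hs.
case: H1 => [[sz [u1 [-> _ n1 [_ _ d1 _]]]]|[pE Q1 P1 [s1 [y1 [x1 [h1 L1]]]]]];
case: H2 => [[sz' [u2 [-> _ n2 [_ _ d2 _]]]]|[pE' Q2 P2 [s2 [y2 [x2 [h2 L2]]]]]].
- by rewrite (dead_unique sp sz n1 n2 d1 d2).
- by rewrite pE' in sz.
- by rewrite pE in sz'.
case: L1 => [[b1 st1 sh1 hx1 us1] K1]; case: L2 => [[b2 st2 sh2 hx2 us2] K2].
have [_ yQ1 _] := step_mem st1; have [_ yQ2 _] := step_mem st2.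
have notun y Q : Q \in Ps -> y \in Q -> ~~ unused Ps Cs y.
  by move=> h1' h2'; rewrite /unused (memPs_cells _ h1' h2') andbF.
case: (eqVneq (pof w1) (pof w2)) => pw; last first.
  have hh : h1 != h2.
    apply: contra pw => /eqP hh; apply/eqP.
    case: K1 => [[E1 _]|[un1 E1 _]]; case: K2 => [[E2 _]|[un2 E2 _]].
    - by apply: (cov_PP cv Q1 Q2 yQ1); rewrite -E1 hh E2.
    - by have := notun _ _ Q1 yQ1; rewrite -E1 hh un2.
    - by have := notun _ _ Q2 yQ2; rewrite -E2 -hh un1.
    - by rewrite E1 E2 hh.
  rewrite pE in P1 P2 PPs.
  by case: (single_second op PPs Q1 Q2 P1 P2 pw b1 st1 b2 st2 sh1 hx1 us1 sh2 hx2 us2 hh).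
rewrite -pw in b2 st2 Q2 P2; have ss := beg_inj b1 b2; rewrite -{}ss in b2 st2 K2.
have uQ := cov_uniqP cv Q1.
have [yy xx] := step_succU uQ st1 st2.
rewrite -{}yy -{}xx in st2 us2 K2 hx2 yQ2.
have cross h h' : e s h' -> h' = y1 -> e s h -> unused Ps Cs h -> e h x1 -> False.
  move=> sy hy sh un hx; rewrite hy in sy.
  have [L [R [QE fL bR]]] := stepE st1; rewrite pE in PPs P1.
  apply: (insert_single PPs Q1 P1 QE _ fL bR sy un sh); last by rewrite e_sym.
  by rewrite -(eX sy); case: (headP hs).
case: K1 => [[E1 F1]|[un1 _ F1]]; case: K2 => [[E2 F2]|[un2 _ F2]].
- by rewrite F1.
- by case: (cross h2 h1).
- by case: (cross h1 h2).
- by rewrite F1.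
Qed.

Lemma up_unique w w1 w2 : w \in rest -> up w w1 -> up w w2 -> w1 = w2.
Proof. by case/setUP; [exact: up_head_unique | exact: up_inner_unique]. Qed.

(** * Greedy selection *)

Lemma half_indep (c : rel V) (r : V -> nat) (R : {set V}) : symmetric c ->
  (forall w w1 w2, w \in R ->
     [/\ w1 \in R, w1 != w, c w w1 & r w1 <= r w] ->
     [/\ w2 \in R, w2 != w, c w w2 & r w2 <= r w] -> w1 = w2) ->
  exists2 I : {set V}, I \subset R /\ #|R| <= 2 * #|I| &
    forall w w', w \in I -> w' \in I -> w != w' -> ~~ c w w'.
Proof.
move=> cs; have [n] := ubnP #|R|; elim: n R => // n IH R Rn H.
case: (set_0Vmem R) => [->|[w0 w0R]].
  by exists set0; rewrite ?sub0set ?cards0 // => w w'; rewrite inE.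
(* All conflicts of a last element [w] are earlier, so there is at most one; [w] is kept and that
   conflict discarded. *)
have [w wR' wmax] := arg_maxnP r w0R; have wR : w \in R := wR'.
set N := [set w' in R | (w' != w) && c w w'].
have N1 : #|N| <= 1.
  apply/card_le1_eqP => a b; rewrite !inE => /and3P [aR aw ca] /and3P [bR bw cb].
  by apply: (H w b a wR); split => //; apply: wmax.
have cD : #|R| <= #|(R :\ w) :\: N| + 2.
  rewrite (cardsD1 w) wR -(cardsID N (R :\ w)).
  have := subset_leq_card (subsetIr (R :\ w) N); move: N1; clear; lia.
have sub : (R :\ w) :\: N \subset R by apply/subsetP => x; rewrite !inE => /and3P [].
have [||I [IR Ic] In] := IH ((R :\ w) :\: N).
- apply: leq_ltn_trans (subset_leq_card (subsetDl _ _)) _.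
  by move: Rn; rewrite (cardsD1 w R) wR.
- move=> v w1 w2 /(subsetP sub) vR [/(subsetP sub) r1 ? ? ?] [/(subsetP sub) r2 ? ? ?].
  exact: (H v).
exists (w |: I).
  split.
    apply/subsetP => x /setU1P [->//|/(subsetP IR)/(subsetP sub)//].
  have wI : w \notin I by apply/negP => /(subsetP IR); rewrite !inE eqxx andbF.
  by rewrite cardsU1 wI; move: cD Ic; clear; lia.
have free v : v \in I -> ~~ c w v.
  move=> /(subsetP IR); rewrite !inE => /andP [+ /andP [vw vR]].
  by rewrite vR vw.
move=> x y /setU1P [->|xI] /setU1P [->|yI] xy.
- by rewrite eqxx in xy.
- exact: free.
- by rewrite cs free.
- exact: In.
Qed.

(** * Vertices without conflicts, in place of bent heads and of nearly isolated cycles *)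

Lemma conf_sym : symmetric conf.
Proof. by move=> w w'; apply: eq_existsb => z; rewrite andbC. Qed.

Lemma ix_off t w : t \in bent -> w \in restin -> ~~ e w (iu t).
Proof.
move=> tb wr; apply/negP => wu; have /and5P [/andP [un tu] ux ii ps _] := ixP tb.
case: (restin_nbr wr wu) => [[u uU [_ uE]]|[C CCs [zC _ _]]|[b lk]].
- by have [_ _ /(_ t tb)] := U0P uU; rewrite uE eqxx.
- by have := cyc_unused CCs zC; rewrite un.
- have [_ QPs _ _ _] := innerP (restin_inner wr).
  by have := unused_flat un; rewrite (mem_flat QPs) //; case: (link3_mem lk).
Qed.

Lemma ix_rest t : t \in bent -> ix t \notin rest.
Proof.
move=> tb; have /and5P [/andP [un tu] ux ii ps _] := ixP tb.
apply/negP => /setUP [/plain_heads /headP [_ _ xE _]|xr].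
  by have [_ _ _ _] := innerP ii; rewrite xE.
by have := ix_off tb xr; rewrite e_sym ux.
Qed.

Lemma ix_inj : {in bent &, injective ix}.
Proof.
move=> t t' tb tb' tt; apply/eqP/negPn/negP => ntt.
have /and5P [/andP [un tu] ux ii ps _] := ixP tb.
have /and5P [/andP [un' tu'] ux' ii' ps' _] := ixP tb'.
have [_ _ tE _] := headP (bent_heads tb); have [_ _ tE' _] := headP (bent_heads tb').
apply: (isE_share tg tE tE' ntt un tu).
rewrite (inner_unusedU ii un un') //; first by rewrite e_sym.
by rewrite tt e_sym.
Qed.

Lemma ix_ix t t' : t \in bent -> t' \in bent -> conf (ix t) (ix t') -> t = t'.
Proof.
move=> tb tb' /existsP [z /andP [xz xz']]; apply/eqP/negPn/negP => tt.
have /and5P [/andP [un tu] ux ii ps _] := ixP tb.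
have /and5P [/andP [un' tu'] ux' ii' ps' _] := ixP tb'.
have [_ _ tE _] := headP (bent_heads tb); have [_ _ tE' _] := headP (bent_heads tb').
have [_ QPs _ uQ _] := innerP ii; have [_ QPs' _ uQ' _] := innerP ii'.
have share t1 x z1 : inner x -> e x (iu t1) -> unused Ps Cs (iu t1) -> e x z1 ->
    z1 = iu t1 \/ exists b, link3 (pof x) x z1 b.
  move=> ix1 xu un1 xz1; case: (eqVneq z1 (iu t1)) => [|zu]; [by left|right].
  by apply: (inner_nbr ix1 xu _ xz1 zu); apply: unused_flat.
have nf x b : inner x -> link3 (pof x) x z b -> ~~ unused Ps Cs z.
  move=> ix1 lk; have [_ QPs1 _ _ _] := innerP ix1.
  by apply/negP => /unused_flat; rewrite (mem_flat QPs1) //; case: (link3_mem lk).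
have xu : e (ix t) (iu t) by rewrite e_sym.
have xu' : e (ix t') (iu t') by rewrite e_sym.
case: (share _ _ _ ii xu un xz) => [zu|[b lk]];
case: (share _ _ _ ii' xu' un' xz') => [zu'|[b' lk']].
- by apply: (isE_share tg tE tE' tt un tu); rewrite -zu zu'.
- by have := nf _ _ ii' lk'; rewrite zu un.
- by have := nf _ _ ii lk; rewrite zu' un'.
have [_ zQ _] := link3_mem lk; have [_ zQ' _] := link3_mem lk'.
have QQ := cov_PP cv QPs QPs' zQ zQ'; rewrite QQ in lk uQ.
case: (link3_midU uQ' lk' lk) => -[E1 E2].
  by rewrite (ix_inj tb tb' E1) eqxx in tt.
have := ix_lab (bent_heads tb) tb'; rewrite /LAB tb => /negP []; apply/existsP.
by exists z; rewrite E1.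
Qed.

(** An inner [w] would be labelled by [t], but [rest_lab] admits only plain heads. A head [w] would
    label [ix t], unless the common neighbour precedes [ix t] on the path of [w]; then [far_cycle]
    splits off a cycle and joins the rest to the path of [t]. *)
Lemma ix_free t w : t \in bent -> w \in rest -> ~~ conf (ix t) w.
Proof.
move=> tb wr; apply/negP => /existsP [z /andP [xz wz]].
have /and5P [/andP [un tu] ux ii ps nsec] := ixP tb.
have [TPs bt tE _] := headP (bent_heads tb).
have [xX QPs xQ uQ xE] := innerP ii.
have xu : e (ix t) (iu t) by rewrite e_sym.
have zX : z \notin X by rewrite -(eX xz).
case: (eqVneq z (iu t)) => [zu|zu].
  rewrite zu in wz; case/setUP: wr => [wp|wr]; last by have := ix_off tb wr; rewrite wz.
  have [_ _ wE _] := headP (plain_heads wp).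
  apply: (isE_share tg wE tE _ un wz tu).
  by apply: contraTneq wp => ->; rewrite inE tb.
have [b lk] := inner_nbr ii xu (unused_flat un) xz zu.
have [_ zQ _] := link3_mem lk; have zf := mem_flat QPs zQ.
case/setUP: wr => [wp|wr]; last first.
  have [_ QPs' _ uQ' _] := innerP (restin_inner wr).
  case: (restin_nbr wr wz) => [[u uU [_ uE]]|[C CCs [zC _ _]]|[b' lk']].
  - by have [/unused_flat] := U0P uU; rewrite -uE zf.
  - by have := cyc_flat CCs zC; rewrite zf.
  have [_ zQ' _] := link3_mem lk'.
  have QQ := cov_PP cv QPs QPs' zQ zQ'; rewrite QQ in lk.
  case: (link3_midU uQ' lk' lk) => -[E1 E2].
    by have := ix_rest tb; rewrite E1 inE wr orbT.
  have lb : LAB t w by rewrite /LAB tb; apply/existsP; exists z; rewrite E1.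
  have [[u [_ _ _ [tp _ _ _]]]|[u [_ _ _ tp _]]] := rest_lab (bent_heads tb) wr lb.
    by move: tp; rewrite inE tb.
  by move: tp; rewrite inE tb.
have hw := plain_heads wp; have [WPs bw wE _] := headP hw.
case: (eqVneq (pof (ix t)) (pof w)) => pw; last first.
  have lz : labz w z (ix t).
    by rewrite /labz wz pw andbT; apply/orP; left; apply/existsP; exists b.
  by have := ix_lab hw tb; rewrite (LABI wp lz).
case/orP: lk => st.
  have lz : labz w z (ix t).
    by rewrite /labz wz -pw; apply/or3P; constructor 2; apply/existsP; exists b.
  by have := ix_lab hw tb; rewrite (LABI wp lz).
have [L [R [QE fL bR]]] := stepE st; rewrite -pw in bw.
have bL : beg w L by apply: (beg_catl (q := z :: R) fL); rewrite -QE.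
apply: (far_cycle tg QPs QE zX bw wz _ fL bR TPs _ _ un xu tu).
(* If only [w] preceded [z], then [ix t] would have index 2, which [deep] excludes. *)
- rewrite ltnNge; apply/negP => /(size1_beg bL) LE; rewrite LE in fL.
  have bE : b = w := fin_inj fL (fin_rcons w [::]).
  by move: nsec; rewrite /second (step_index uQ st) bE (beg_index bw).
- by rewrite eq_sym.
- by rewrite /isend bt.
Qed.

Context (xc : seq V -> V).
Context (xcP : forall C, C \in Cs -> #|VC C| <= 1 ->
  [/\ xc C \in C, xc C \in X & nbr e (xc C) \subset C]).

(** A neighbour of [xc C] lies on [C]. No head is adjacent to it, and every other candidate has its
    only neighbour off the paths elsewhere. *)
Lemma xc_free C w : C \in Cs -> #|VC C| <= 1 -> conf (xc C) w ->
  w \notin rest /\ (forall t, t \in bent -> w != ix t).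
Proof.
move=> CCs sC /existsP [z /andP [xz wz]]; have [xC xX sub] := xcP CCs sC.
have zC : z \in C by apply: (subsetP sub); rewrite inE.
have nf := cyc_flat CCs zC; have nu := cyc_unused CCs zC.
split.
  apply/negP => /setUP [/plain_heads /headP [PPs bw _ _]|wr].
    by apply: (@end_cyc_adj Ps Cs (pof w) C w z tg PPs CCs) => //; rewrite /isend bw.
  case: (restin_nbr wr wz) => [[u /U0P [un _ _] [_ uE]]|[C' CCs' [zC' _ bC]]|[b lk]].
  - by rewrite uE un in nu.
  - by move: bC; rewrite -(cov_CC cv CCs CCs' zC zC') ltnNge sC.
  - have [_ QPs _ _ _] := innerP (restin_inner wr).
    by rewrite (mem_flat QPs) // in nf; case: (link3_mem lk).
move=> t tb; apply: contraNneq nu => wE; rewrite wE in wz.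
have /and5P [/andP [un tu] ux ii ps nsec] := ixP tb.
by rewrite (inner_off ii _ (unused_flat un) wz nf) // e_sym.
Qed.

(** * Counting *)

Lemma card_count p (A : {set V}) : uniq p -> count (mem A) p = #|[set v in A | v \in p]|.
Proof.
move=> up; rewrite -size_filter -(card_uniqP (filter_uniq (mem A) up)).
by apply: eq_card => v; rewrite !inE mem_filter.
Qed.

Lemma path_count x p : path e x p -> count (mem X) (x :: p) + 1 =
  count (mem (~: X)) (x :: p) + (x \in X) + (last x p \in X).
Proof.
elim: p x => [|b p IH] x /=; first by rewrite !inE; case: (x \in X).
case/andP => xb /IH /=; rewrite !inE (eX xb); case: (b \in X) => /=; clear; lia.
Qed.

Lemma xpath_count p : xpath p -> count (mem X) p = count (mem (~: X)) p + 1.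
Proof.
case: p => // x p /and3P [xX /path_count + lX].
by rewrite xX lX; clear; lia.
Qed.

Lemma xcyc_count C : xcyc C -> count (mem X) C = count (mem (~: X)) C.
Proof.
move=> xC; have [y [p [/permP pe xp yX]]] : exists y p,
    [/\ perm_eq C (y :: p), xpath p & y \notin X].
  case: C xC => // v C xC; case: (boolP (v \in X)) => vX.
    by have [y [p [? ? _ ?]]] := cyc_openX xC (mem_head v C) vX; exists y, p.
  by have [p [a [b [? ? _ _ _]]]] := cyc_openY xC (mem_head v C) vX; exists v, p.
by rewrite !pe /= !inE (negbTE yX) (xpath_count xp) addn1.
Qed.

Lemma paths_count Rs : all xpath Rs ->
  count (mem X) (flatten Rs) = count (mem (~: X)) (flatten Rs) + size Rs.
Proof.
elim: Rs => // p Rs IH /andP [xp /IH E].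
by rewrite flatten_cons !count_cat E (xpath_count xp); rewrite [size (_ :: _)]/=; clear; lia.
Qed.

Lemma cycs_count Rs : all xcyc Rs ->
  count (mem X) (flatten Rs) = count (mem (~: X)) (flatten Rs).
Proof.
by elim: Rs => // p Rs IH /andP [xp /IH E]; rewrite flatten_cons !count_cat E xcyc_count.
Qed.

Lemma double_count (A B : {set V}) :
  \sum_(x in A) #|nbr e x :&: B| = \sum_(y in B) #|nbr e y :&: A|.
Proof.
have E (A' B' : {set V}) : \sum_(x in A') #|nbr e x :&: B'| =
    \sum_(x in A') \sum_(y in B') (e x y : nat).
  apply: eq_bigr => x _; rewrite -sum1_card big_mkcond [RHS]big_mkcond /=.
  by apply: eq_bigr => y _; rewrite !inE; case: (e x y); case: (y \in B').
by rewrite !E exchange_big /=; apply: eq_bigr => y _; apply: eq_bigr => x _; rewrite e_sym.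
Qed.

Lemma card_X : #|X| = #|~: X|.
Proof.
have side (S : {set V}) : (forall x w, x \in S -> e x w -> w \in ~: S) ->
    \sum_(x in S) #|nbr e x :&: ~: S| = #|S| * 3.
  move=> H; rewrite -sum_nat_const; apply: eq_bigr => x xS.
  rewrite (setIidPl _) ?deg3 //; apply/subsetP => w; rewrite [_ \in nbr _ _]inE; exact: H.
have h1 := side X; have h2 := side (~: X); rewrite setCK in h2.
have := double_count X (~: X); rewrite {}h1 ?{}h2; first by clear; lia.
- by move=> x w; rewrite inE => xX /eX' <-.
- by move=> x w xX /eX; rewrite xX inE => <-.
Qed.

Definition U := [set u | unused Ps Cs u].

Lemma card_U : #|U| = size Ps.
Proof.
have [xP xC un sub] := cv.
have := paths_count xP; have := cycs_count xC.
have E1 : count (mem X) (cells Ps Cs) = #|X|.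
  by rewrite card_count //; apply: eq_card => v; rewrite !inE; apply: andb_idr; exact: sub.
have E2 : count (mem (~: X)) (cells Ps Cs) + #|U| = #|~: X|.
  rewrite card_count // -[RHS](cardsID [set v in cells Ps Cs]); congr (_ + _).
    by apply: eq_card => v; rewrite !inE.
  by apply: eq_card => v; rewrite !inE andbC.
move: E1 E2; rewrite /cells !count_cat card_X; clear; lia.
Qed.

Lemma card_has (Rs : seq (seq V)) (F : seq V -> {set V}) : uniq Rs ->
  (forall C C' v, C \in Rs -> C' \in Rs -> v \in F C -> v \in F C' -> C = C') ->
  #|[set v | has (fun C => v \in F C) Rs]| = \sum_(C <- Rs) #|F C|.
Proof.
elim: Rs => [|C Rs IH] /=.
  by move=> _ _; rewrite big_nil; apply/eqP; rewrite cards_eq0; apply/eqP/setP => v; rewrite !inE.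
case/andP => CR uR H; rewrite big_cons -IH //; last first.
  by move=> D D' v DR DR'; apply: H; rewrite inE ?DR ?DR' orbT.
have -> : [set v | (v \in F C) || has (fun D => v \in F D) Rs] =
    F C :|: [set v | has (fun D => v \in F D) Rs].
  by apply/setP => v; rewrite !inE.
rewrite cardsU (_ : _ :&: _ = set0) ?cards0 ?subn0 //.
apply/setP => v; rewrite !inE; apply/negP => /andP [vC /hasP [D DR vD]].
have DE : C = D by apply: (H C D v) => //; rewrite inE ?eqxx // DR orbT.
by rewrite DE DR in CR.
Qed.

Lemma uniq_flatten (Rs : seq (seq V)) : uniq (flatten Rs) -> [::] \notin Rs -> uniq Rs.
Proof.
elim: Rs => // p Rs IH; rewrite flatten_cons cat_uniq inE => /and3P [_ pd uR] /norP [pn nR].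
rewrite /= IH // andbT; case: p pn pd => // v p _ /hasPn pd.
apply/negP => pR; have /pd : v \in flatten Rs by apply/flattenP; exists (v :: p); rewrite ?mem_head.
by rewrite mem_head.
Qed.

Lemma uniq_Ps : uniq Ps.
Proof.
have [/allP xP _ un _] := cv; apply: uniq_flatten; last by apply/negP => /xP.
by move: un; rewrite cat_uniq => /and3P [].
Qed.

Lemma uniq_Cs : uniq Cs.
Proof.
have [_ /allP xC un _] := cv; apply: uniq_flatten; last by apply/negP => /xC.
by move: un; rewrite cat_uniq => /and3P [].
Qed.

Lemma card_heads : #|heads| = size Ps.
Proof.
have -> : heads = [set v | has (fun P => v \in [set s | beg s P]) Ps].
  apply/setP => v; rewrite !inE; apply/idP/hasP => [/andP [/pofP [PPs _] b]|[P PPs]].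
    by exists (pof v); rewrite ?inE.
  by rewrite inE => b; rewrite (pofE PPs (beg_mem b)) b (mem_flat PPs (beg_mem b)).
rewrite card_has ?uniq_Ps //; last first.
  by move=> P P' v PPs PPs'; rewrite !inE => /beg_mem h /beg_mem h'; apply: (cov_PP cv PPs PPs' h h').
rewrite -sum1_size !big_seq; apply: eq_bigr => P PPs.
have [x bx _] := xpath_begE (cov_xpath cv PPs).
apply/eqP/cards1P; exists x; apply/setP => v; rewrite !inE.
by apply/idP/eqP => [/(beg_inj bx)|->].
Qed.

Definition cyc_in (C : seq V) := [set u | unused Ps Cs u && (nbr e u \subset C)].

Section OneCycle.
Context (C : seq V) (CCs : C \in Cs).

Let A := [set v in X | v \in C].
Let D := [set v in ~: X | v \in C].
Let O := ~: [set v in C].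

Lemma cyc_card : #|A| = #|D|.
Proof.
have uC := cov_uniqC cv CCs.
by rewrite -!card_count // xcyc_count //; apply: cov_xcyc cv _ CCs.
Qed.

Lemma cyc_card2 : 1 < #|A|.
Proof.
have uC := cov_uniqC cv CCs; have /andP [_ sC] := cov_xcyc cv CCs.
have : #|A| + #|D| = size C.
  have -> : size C = #|[set v in C]| by rewrite cardsE; apply/esym/card_uniqP.
  rewrite -(cardsID X [set v in C]); congr (_ + _); last first.
    by apply: eq_card => v; rewrite !inE.
  by apply: eq_card => v; rewrite !inE andbC.
by rewrite -cyc_card; move: sC; clear; lia.
Qed.

(** [A] and [D] have equal size, hence equally many incident edges, and the edges between them are
    counted on both sides. *)
Lemma cyc_out_sum : \sum_(x in A) #|nbr e x :&: O| = \sum_(y in D) #|nbr e y :&: O|.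
Proof.
have split3 (S T : {set V}) : (forall v, v \in S -> nbr e v :&: [set w in C] = nbr e v :&: T) ->
    \sum_(x in S) #|nbr e x :&: O| + \sum_(x in S) #|nbr e x :&: T| = 3 * #|S|.
  move=> ST; rewrite -big_split mulnC -sum_nat_const; apply: eq_bigr => v vS /=.
  by rewrite -ST // addnC -setDE cardsID deg3.
have h1 := split3 A D; have h2 := split3 D A.
have : \sum_(x in A) #|nbr e x :&: D| = \sum_(x in D) #|nbr e x :&: A| by exact: double_count.
have e1 : forall v, v \in A -> nbr e v :&: [set w in C] = nbr e v :&: D.
  move=> v; rewrite inE => /andP [vX _]; apply/setP => w; rewrite !inE.
  by case: (boolP (e v w)) => //= /eX; rewrite vX => <-.
have e2 : forall v, v \in D -> nbr e v :&: [set w in C] = nbr e v :&: A.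
  move=> v; rewrite !inE => /andP [vX _]; apply/setP => w; rewrite !inE.
  by case: (boolP (e v w)) => //= /eX' ; rewrite vX => <-.
by move: (h1 e1) (h2 e2); rewrite cyc_card; clear; lia.
Qed.

(** No end and no vertex of another cycle is adjacent to [D], and an inner vertex has only one
    neighbour off the paths, so it receives at most one of these edges. *)
Lemma cyc_out_VC : \sum_(y in D) #|nbr e y :&: O| <= #|VC C|.
Proof.
rewrite double_count -sum1_card (bigID (mem (VC C))) /= [X in _ + X]big1 => [|v].
  rewrite addn0 [X in _ <= X](big_mkcond) [X in X <= _](big_mkcond) /=.
  apply: leq_sum => v _; case: (boolP (v \in VC C)) => vV; rewrite ?andbF // andbT.
  case: ifP => // _; apply/card_le1_eqP => y y'; rewrite !inE.
  move=> /and3P [vy _ yC] /and3P [vy' _ yC'].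
  move: vV; rewrite inE => /andP [iv _].
  by apply: (inner_off iv vy (cyc_flat CCs yC) vy' (cyc_flat CCs yC')).
case/andP; rewrite inE inE => vC vV; apply/eqP; rewrite cards_eq0; apply/set0Pn.
move=> [y]; rewrite !inE => /and3P [vy yX yC].
have vX : v \in X by rewrite (eX vy).
case: (X_cases vX) => [iv|/hasP [P PPs vP]|[C' CCs' vC']].
- case/negP: vV; rewrite inE iv; apply/hasP; exists y => //.
  by rewrite yX e_sym.
- exact: (end_cyc_adj tg PPs CCs vP yC vy).
- have CC : C' != C by apply: contra vC => /eqP <-.
  exact: (cyc_cyc_adj tg CCs' CCs CC vC' vX yC vy).
Qed.

Lemma cyc_in_out : 3 * #|cyc_in C| <= \sum_(x in A) #|nbr e x :&: O|.
Proof.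
rewrite double_count mulnC -sum_nat_const.
have sub : cyc_in C \subset O.
  apply/subsetP => u; rewrite !inE => /andP [un _]; apply: contraTN un => uC.
  exact: cyc_unused uC.
rewrite (bigID (mem (cyc_in C)) (mem O)) /=; apply: leq_trans (leq_addr _ _).
rewrite [X in X <= _]big_mkcond [X in _ <= X]big_mkcond; apply: leq_sum => u _ /=.
case: (boolP (u \in cyc_in C)) => uC; rewrite ?andbF // (subsetP sub) //=.
move: uC; rewrite inE => /andP [un uC].
have -> : nbr e u :&: A = nbr e u; last by rewrite deg3.
apply/setIidPl/subsetP => x ux; have xC := subsetP uC x ux; rewrite inE xC andbT.
by move: ux; rewrite inE; exact: unused_X un.
Qed.

Lemma cyc_bound : 3 * #|cyc_in C| <= #|VC C|.
Proof. by apply: leq_trans cyc_in_out _; rewrite cyc_out_sum; exact: cyc_out_VC. Qed.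

(** At most one edge leaves [C] from its vertices in X, of which there are at least two. *)
Lemma cyc_free : #|VC C| <= 1 -> exists x, [/\ x \in C, x \in X & nbr e x \subset C].
Proof.
move=> V1; have : [exists x, (x \in A) && (nbr e x \subset C)].
  apply: contraLR V1; rewrite -ltnNge negb_exists => /forallP H.
  apply: leq_trans (leq_trans cyc_card2 _) cyc_out_VC; rewrite -cyc_out_sum.
  rewrite -sum1_card; apply: leq_sum => x xA; rewrite card_gt0; apply/set0Pn.
  have := H x; rewrite xA /= => /subsetPn [y xy yC]; exists y.
  by rewrite !inE in xy *; rewrite xy.
by case/existsP => x; rewrite inE -andbA => /and3P [xX xC sub]; exists x.
Qed.

End OneCycle.

Lemma xc_in C : C \in Cs -> #|VC C| <= 1 -> xc C \in C.
Proof. by move=> CCs /(xcP CCs) []. Qed.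

Lemma card_Vc : #|Vc| = \sum_(C <- Cs) (if 1 < #|VC C| then #|VC C| else 0).
Proof.
pose F C := if 1 < #|VC C| then VC C else set0.
have -> : Vc = [set v | has (fun C => v \in F C) Cs].
  apply/setP => v; rewrite !inE; apply: eq_has => C; rewrite /F.
  by case: ifP => // _; rewrite in_set0.
rewrite card_has ?uniq_Cs //.
  by apply: eq_bigr => C _; rewrite /F; case: ifP; rewrite ?cards0.
have FP C v : v \in F C -> inner v /\ exists2 y, y \in C & e v y.
  rewrite /F; case: ifP => _; last by rewrite in_set0.
  by rewrite inE => /andP [iv /hasP [y yC /andP [_ yv]]]; split => //; exists y; rewrite 1?e_sym.
move=> C C' v CCs CCs' /FP [iv [y yC vy]] /FP [_ [y' yC' vy']].
have yy := inner_off iv vy (cyc_flat CCs yC) vy' (cyc_flat CCs' yC').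
by rewrite yy in yC'; exact: (cov_CC cv CCs CCs' yC yC').
Qed.

Lemma card_U0 : size Ps <= #|U0| + \sum_(C <- Cs) #|cyc_in C| + #|bent|.
Proof.
rewrite -card_U -card_has ?uniq_Cs //; last first.
  move=> C C' u CCs CCs'; rewrite !inE => /andP [_ /subsetP uC] /andP [_ /subsetP uC'].
  have /card_gt0P [x ux] : 0 < #|nbr e u| by rewrite deg3.
  exact: (cov_CC cv CCs CCs' (uC _ ux) (uC' _ ux)).
set CI := [set v | _].
have sub : U \subset U0 :|: CI :|: iu @: bent.
  apply/subsetP => u; rewrite inE => un; rewrite !in_setU !inE un /=.
  case: (boolP (cycint u)) => [cu|_] /=; last by rewrite orbAC orNb.
  rewrite (_ : has _ Cs) //; apply: etrans cu; apply: eq_has => C.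
  by rewrite inE un.
apply: leq_trans (subset_leq_card sub) _.
apply: leq_trans (leq_card_setU _ _) _.
apply: leq_add; first exact: leq_card_setU.
exact: leq_imset_card.
Qed.

Lemma card_restin : #|restin| = #|U0| + #|Vc|.
Proof.
rewrite cardsU (_ : _ :&: _ = set0) ?cards0 ?subn0.
  rewrite card_in_imset // => u u' /U0P [un [iw uw _ _] _] /U0P [un' [iw' uw' _ _] _] pp.
  by apply: (inner_unusedU iw un un'); rewrite e_sym // pp.
apply/setP => v; rewrite !inE; apply/negP => /andP [/imsetP [u /U0P [un [iw uw _ _] _] vE]].
case/hasP => C CCs /andP [_]; rewrite inE vE => /andP [iv /hasP [y yC /andP [_ yv]]].
rewrite e_sym in uw; rewrite e_sym in yv.
have uy := inner_off iw uw (unused_flat un) yv (cyc_flat CCs yC).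
by have := cyc_unused CCs yC; rewrite uy un.
Qed.

Lemma card_plain : #|plain| + #|bent| = size Ps.
Proof.
rewrite -card_heads -(cardsID bent heads) addnC; congr (_ + _).
by apply: eq_card => s; rewrite !inE andbA andbb.
Qed.

Lemma card_rest : 2 * size Ps + 2 * \sum_(C <- Cs) (1 < #|VC C|) <= #|rest| + 2 * #|bent|.
Proof.
have -> : #|rest| = #|plain| + #|restin|.
  rewrite cardsU (_ : _ :&: _ = set0) ?cards0 ?subn0 //.
  apply/setP => v; rewrite in_setI in_set0; apply/negP => /andP [/plain_heads /headP [_ _ vE _]].
  by move=> /restin_inner /innerP [_ _ _ _]; rewrite vE.
(* With k = |cyc_in C| and n = |VC C|, the bound 3k <= n gives k + 2 <= n if n >= 2, and k = 0 if n
   <= 1. *)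
have cyc : \sum_(C <- Cs) #|cyc_in C| + 2 * \sum_(C <- Cs) (1 < #|VC C|) <= #|Vc|.
  rewrite card_Vc big_distrr -big_split /= !big_seq; apply: leq_sum => C CCs.
  by have := cyc_bound CCs; case: ltnP; clear; lia.
rewrite card_restin; move: card_U0 card_plain cyc.
by move: (bigop _ _ _) (bigop _ _ _); clear; lia.
Qed.

Definition small := [set v | has (fun C => (#|VC C| <= 1) && (v == xc C)) Cs].

Lemma smallP v : v \in small -> exists C, [/\ C \in Cs, #|VC C| <= 1 & v = xc C].
Proof. by rewrite inE => /hasP [C CCs /andP [sC /eqP ->]]; exists C. Qed.

Lemma card_small : #|small| = \sum_(C <- Cs) (#|VC C| <= 1).
Proof.
pose F C := if #|VC C| <= 1 then [set xc C] else set0.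
have -> : small = [set v | has (fun C => v \in F C) Cs].
  apply/setP => v; rewrite !inE; apply: eq_has => C; rewrite /F.
  by case: ifP => _; rewrite inE.
rewrite card_has ?uniq_Cs //.
  by apply: eq_bigr => C _; rewrite /F; case: ifP; rewrite ?cards0 ?cards1.
move=> C C' v CCs CCs'; rewrite /F.
case: ifP => sC; last by rewrite in_set0.
case: ifP => sC'; last by rewrite in_set0.
rewrite !inE => /eqP -> /eqP E.
by apply: (cov_CC cv CCs CCs' (xc_in CCs sC)); rewrite E xc_in.
Qed.

Lemma independent_exists : exists S : {set V}, [/\ S \subset X,
  (forall w w', w \in S -> w' \in S -> w != w' -> ~~ conf w w') &
  size Ps + size Cs <= #|S|].
Proof.
have [|I [IR Ic] In] := half_indep (c := conf) (r := rank) (R := rest) conf_sym.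
  by move=> w w1 w2 wr h1 h2; apply: (up_unique wr h1 h2).
exists (I :|: (ix @: bent) :|: small).
have inn t : t \in bent -> inner (ix t) by move=> /ixP /and5P [].
have smi v : v \in small -> ~~ inner v.
  move=> /smallP [C [CCs sC ->]]; apply/negP => iv.
  by have := inner_cyc iv CCs; rewrite xc_in.
have smr v : v \in small -> v \notin rest.
  move=> vs; apply/negP => /setUP [/plain_heads hv|/restin_inner iv]; last first.
    by have := smi _ vs; rewrite iv.
  have [C [CCs sC vE]] := smallP vs; have := cyc_flat CCs (xc_in CCs sC).
  by rewrite -vE (head_flat hv).
split.
- apply/subsetP => v /setUP [/setUP [/(subsetP IR)|/imsetP [t tb ->]]|/smallP [C [CCs sC ->]]].
  + case/setUP => [/plain_heads /headP [] //|/restin_inner /innerP [] //].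
  + by case: (innerP (inn _ tb)).
  + by case: (xcP CCs sC).
- have half w w' : w \in I :|: (ix @: bent) :|: small -> w' \in (ix @: bent) :|: small ->
      w != w' -> ~~ conf w w'.
    move=> wS /setUP [/imsetP [t tb ->]|/smallP [C [CCs sC ->]]] ww; apply/negP => cf.
      case/setUP: wS => [/setUP [/(subsetP IR) wr|/imsetP [t' tb' wE]]|/smallP [C [CCs sC wE]]].
      + by have := ix_free tb wr; rewrite conf_sym cf.
      + by rewrite wE in ww cf; rewrite (ix_ix tb' tb cf) eqxx in ww.
      + rewrite wE in ww cf; have [_ /(_ t tb)] := xc_free CCs sC cf.
        by rewrite eqxx.
    rewrite conf_sym in cf; have [nr nx'] := xc_free CCs sC cf.
    case/setUP: wS => [/setUP [/(subsetP IR) wr|/imsetP [t' tb' wE]]|/smallP [C' [CCs' sC' wE]]].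
    + by rewrite wr in nr.
    + by have := nx' _ tb'; rewrite wE eqxx.
    + rewrite wE in cf ww; case/existsP: cf => z /andP [xz xz'].
      have [_ _ /subsetP s1] := xcP CCs sC; have [_ _ /subsetP s2] := xcP CCs' sC'.
      have z1 : z \in C by apply: s1; rewrite inE.
      have z2 : z \in C' by apply: s2; rewrite inE.
      by rewrite (cov_CC cv CCs CCs' z1 z2) eqxx in ww.
  move=> w w' wS; rewrite -setUA => /setUP [wI'|]; last exact: half.
  move=> ww; move: wS; rewrite -setUA => /setUP [wI|wS]; first exact: In.
  by rewrite conf_sym half // 1?eq_sym // -setUA inE wI'.
have d1 : I :&: ix @: bent = set0.
  apply/setP => v; rewrite in_setI in_set0; apply/negP => /andP [/(subsetP IR) vr /imsetP [t tb vE]].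
  by have := ix_rest tb; rewrite -vE vr.
have d2 : (I :|: ix @: bent) :&: small = set0.
  apply/setP => v; rewrite in_setI in_set0; apply/negP => /andP [+ vs].
  case/setUP => [/(subsetP IR)|/imsetP [t tb vE]]; first by apply/negP; exact: smr.
  by have := smi _ vs; rewrite vE inn.
rewrite cardsU d2 cards0 subn0 cardsU d1 cards0 subn0 (card_in_imset ix_inj) card_small.
have sz : size Cs = \sum_(C <- Cs) (1 < #|VC C|) + \sum_(C <- Cs) (#|VC C| <= 1).
  by rewrite -big_split -sum1_size; apply: eq_bigr => C _ /=; case: ltnP.
rewrite sz; move: card_rest Ic; move: (bigop _ _ _) (bigop _ _ _); clear; lia.
Qed.

(** * Existence of the guides and of the picks *)

Lemma plain_cands s u : s \in plain -> 1 < size (pof s) -> unused Ps Cs u -> e s u ->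
  exists a b, [/\ a != b, inner a /\ inner b, e u a /\ e u b & pof a = pof s /\ pof b = pof s].
Proof.
move=> sp sz un su; have : #|nbr e u| == 3 by rewrite deg3.
rewrite (cardsD1 s) inE e_sym su => /cards2P [a [b [ab E]]].
have mz z : z \in [set a; b] -> z != s /\ e u z by rewrite -E !inE => /andP.
have [as' ua] : a != s /\ e u a by apply: mz; rewrite !inE eqxx.
have [bs' ub] : b != s /\ e u b by apply: mz; rewrite !inE eqxx orbT.
have [ia pa] := plain_near sp sz un su ua as'.
have [ib pb] := plain_near sp sz un su ub bs'.
by exists a, b.
Qed.

(* With two unused neighbours, the two picks must not be consecutive; a path cannot
   make all four pairs of candidates consecutive. *)
Lemma guide_exists s : exists g, guide s g.
Proof.
case: (boolP ((s \in plain) && (1 < size (pof s)))) => [/andP [sp sz]|n]; last first.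
  by exists id => sp sz; rewrite sp sz in n.
have [PPs bs sE sX] := headP (plain_heads sp).
have uP := cov_uniqP cv PPs; have xP := cov_xpath cv PPs.
have [y1 [b1 st1]] := beg_second xP bs sz.
have [sy _] := step_adj xP st1; have [_ yP _] := step_mem st1.
have : #|nbr e s| == 3 by rewrite deg3.
rewrite (cardsD1 y1) inE sy => /cards2P [z1 [z2 [zz zE]]].
have mz z : (z \in [set z1; z2]) = (z != y1) && e s z by rewrite -zE !inE.
have sz1 : e s z1 by have := mz z1; rewrite !inE eqxx => /esym /andP [].
have sz2 : e s z2 by have := mz z2; rewrite !inE eqxx orbT => /esym /andP [].
have unz u : unused Ps Cs u -> e s u -> u = z1 \/ u = z2.
  move=> un su; have := mz u; rewrite su andbT !inE.
  case: (eqVneq u y1) => [uy|_ /orP [] /eqP]; [|by left|by right].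
  by have := unused_flat un; rewrite uy (mem_flat PPs yP).
have foot w y b : inner w -> step (pof s) w y b -> e s y ->
    (y = z1 \/ y = z2) /\ ~~ unused Ps Cs y.
  move=> iw st sy'; have [_ yQ _] := step_mem st; split; last first.
    by apply/negP => /unused_flat; rewrite (mem_flat PPs yQ).
  have := mz y; rewrite sy' andbT !inE.
  case: (eqVneq y y1) => [yy|_ /orP [] /eqP]; [|by left|by right].
  rewrite yy in st; have [ws _] := step_midU uP st st1.
  by have [_ _ _ _] := innerP iw; rewrite ws sE.
pose good u w := [/\ inner w, e u w, pof w = pof s &
  forall y b, step (pof s) w y b -> ~~ e s y].
suff [w1 [w2 [g1 g2 no]]] : exists w1 w2, [/\ unused Ps Cs z1 -> good z1 w1,
    unused Ps Cs z2 -> good z2 w2 & unused Ps Cs z1 -> unused Ps Cs z2 ->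
    forall y, ~~ step (pof s) w1 y w2 /\ ~~ step (pof s) w2 y w1].
  exists (fun u => if u == z1 then w1 else w2) => _ _.
  have irr w y : ~~ step (pof s) w y w.
    by apply/negP => /(step_neq uP); rewrite eqxx.
  have zz' : z2 == z1 = false by rewrite eq_sym (negbTE zz).
  split=> [u un su|u u' y un un' su su'].
    by case: (unz u un su) => uE; rewrite uE ?eqxx ?zz' in un *; [exact: g1|exact: g2].
  case: (unz u un su) => uE; case: (unz u' un' su') => uE';
    rewrite uE in un *; rewrite uE' in un' *; rewrite ?eqxx ?zz' //.
  - by case: (no un un' y).
  - by case: (no un' un y).
have one u v : unused Ps Cs u -> e s u -> ~~ unused Ps Cs v ->
    (forall y, y = z1 \/ y = z2 -> ~~ unused Ps Cs y -> y = v) -> exists w, good u w.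
  move=> un su nv foots; have [a [b [ab [ia ib] [ua ub] [pa pb]]]] := plain_cands sp sz un su.
  have dec w : inner w -> e u w -> pof w = pof s -> good u w \/ exists c, step (pof s) w v c.
    move=> iw uw pw; case: (boolP [exists c, step (pof s) w v c]) => [/existsP|nc]; first by right.
    left; split => // y c st; apply/negP => sy'; have [h1 h2] := foot w y c iw st sy'.
    by case/negP: nc; apply/existsP; exists c; rewrite -(foots y h1 h2).
  case: (dec a ia ua pa) => [ga|[c st]]; first by exists a.
  case: (dec b ib ub pb) => [gb|[c' st']]; first by exists b.
  by have [E _] := step_midU uP st st'; rewrite E eqxx in ab.
case: (boolP (unused Ps Cs z1)) => u1; case: (boolP (unused Ps Cs z2)) => u2; last 1 first.
- by exists s, s.
- have [a [b [ab [ia ib] [ua ub] [pa pb]]]] := plain_cands sp sz u1 sz1.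
  have [c [d [cd [ic id] [uc ud] [pc pd]]]] := plain_cands sp sz u2 sz2.
  have gd u w : inner w -> e u w -> pof w = pof s -> good u w.
    move=> iw uw pw; split => // y t st; apply/negP => sy'.
    by have [[] ->] := foot w y t iw st sy'; rewrite ?u1 ?u2.
  pose far x w := (index x (pof s) + 2 != index w (pof s)) &&
    (index w (pof s) + 2 != index x (pof s)).
  have farP x w : far x w -> forall y, ~~ step (pof s) x y w /\ ~~ step (pof s) w y x.
    move=> /andP [f1 f2] y; split; apply/negP => /(step_index uP) E.
      by rewrite E addn2 eqxx in f1.
    by rewrite E addn2 eqxx in f2.
  have ne x w : inner x -> pof x = pof s -> x != w -> index x (pof s) != index w (pof s).
    by move=> ix' px; apply: contra => /eqP /index_injQ -> //; rewrite -px; case: (innerP ix').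
  have : [|| far a c, far a d, far b c | far b d].
    have := ne _ _ ia pa ab; have := ne _ _ ic pc cd; rewrite /far.
    move: (index a _) (index b _) (index c _) (index d _); clear; lia.
  by case/or4P => /farP f; [exists a, c|exists a, d|exists b, c|exists b, d]; split => // *; exact: gd.
- have [w gw] : exists w, good z1 w.
    by apply: (one z1 z2) => // y [] -> //; rewrite u1.
  by exists w, w; split.
- have [w gw] : exists w, good z2 w.
    by apply: (one z2 z1) => // y [] -> //; rewrite u2.
  by exists w, w; split.
Qed.

(** If all neighbours of a [ntype] vertex are labelled, one head labels them all by
    [ntype_lab_head], and [dead_plain] finds one off its path. For other [u] the guide of an
    adjacent head decides, if there is one; if not, an inner neighbour exists, since [u] neither
    touches two cycles nor has all its neighbours on one. *)
Lemma pick_exists u : exists w, unused Ps Cs u -> ~~ cycint u -> pick_spec u w.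
Proof.
case: (boolP (unused Ps Cs u)) => un; last by exists u.
case: (boolP (cycint u)) => nc; first by exists u.
have [x0 ux0] : exists x, e u x.
  by have /card_gt0P [x] : 0 < #|nbr e u|; rewrite ?deg3 // inE; exists x.
case: (boolP (ntype u)) => nu.
  have nohead s : s \in heads -> ~~ e s u.
    move=> hs; apply/negP; rewrite e_sym => /(ntypeP nu) /innerP [_ _ _ _].
    by case: (headP hs) => _ _ ->.
  have gd s w : s \in plain -> 1 < size (pof s) -> e s u -> w = G s u.
    by move=> /plain_heads /nohead /negbTE ->.
  case: (boolP [exists x, e u x && [forall s in heads, ~~ LAB s x]]) => [|all].
    case/existsP => x /andP [ux /forallP H]; exists x => _ _; split => //.
    - exact: ntypeP nu ux.
    - by move=> _; left => s hs; have := H s; rewrite hs.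
    - by move=> s; exact: gd.
  have labelled x : e u x -> exists2 s, s \in heads & LAB s x.
    move=> ux; move: all; rewrite negb_exists => /forallP /(_ x); rewrite ux /=.
    rewrite negb_forall => /existsP [s]; rewrite negb_imply negbK => /andP [? ?].
    by exists s.
  have [s hs lb] := labelled x0 ux0.
  have [h [y [xh lb']]] := LAB_lab hs (ntypeP nu ux0) lb.
  have du : dead s u.
    apply/forallP => x; apply/implyP => ux; case: (eqVneq x0 x) => [<-//|xx].
    have [s' hs' lb1] := labelled x ux.
    have [h1 [y1 [xh1 lb1']]] := LAB_lab hs' (ntypeP nu ux) lb1.
    by rewrite (ntype_lab_head nu hs lb' hs' lb1' ux0 ux xx).
  have [sp sz [x ux px]] := dead_plain hs nu du.
  exists x => _ _; split => //; first exact: ntypeP nu ux.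
  - by move=> _; right; exists s.
  - by move=> s'; exact: gd.
case: (boolP [exists s, [&& s \in plain, 1 < size (pof s) & e s u]]).
  case/existsP => s /and3P [sp sz su].
  have [/(_ u un su) [ig ug pg c1] _] := GP sp sz.
  exists (G s u) => _ _; split => //; first by rewrite (negbTE nu).
  move=> s' sp' _ su'; suff -> : s' = s by [].
  have [_ _ sE _] := headP (plain_heads sp); have [_ _ sE' _] := headP (plain_heads sp').
  by apply/eqP/negPn/negP => ss; apply: (isE_share tg sE' sE ss un su' su).
move=> ng; have gd w s : s \in plain -> 1 < size (pof s) -> e s u -> w = G s u.
  by move=> sp sz su; case/negP: ng; apply/existsP; exists s; rewrite sp sz su.
suff [w iw uw] : exists2 w, inner w & e u w.
  exists w => _ _; split => //; first by rewrite (negbTE nu).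
  by move=> s; exact: gd.
case: (boolP [exists x, e u x && isE Ps x]) => [/existsP [f /andP [uf fE]]|nE].
  have : #|nbr e u| == 3 by rewrite deg3.
  rewrite (cardsD1 f) inE uf => /cards2P [x [x' [_ E]]].
  have : x \in nbr e u :\ f by rewrite E !inE eqxx.
  rewrite !inE => /andP [xf ux]; exists x => //.
  by apply: (head_inner fE un _ ux xf); rewrite e_sym.
have cases x : e u x -> inner x \/ exists2 C, C \in Cs & x \in C.
  move=> ux; case: (X_cases (unused_X un ux)) => [|xE|]; [by left| |by right].
  by case/negP: nE; apply/existsP; exists x; rewrite ux.
case: (cases x0 ux0) => [|[C CCs xC]]; first by exists x0.
have /subsetPn [x] : ~~ (nbr e u \subset C).
  by apply: contra nc => sub; apply/hasP; exists C.
rewrite inE => ux nxC; case: (cases x ux) => [|[C' CCs' xC']]; first by exists x.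
have CC : C != C' by apply: contra nxC => /eqP ->.
case: (@cyc_cyc_share Ps Cs C C' x0 x u) => //; try exact: unused_X un _.
- exact: tg.
- by rewrite e_sym.
- by rewrite e_sym.
Qed.

End Optimal.

(** * Making the choices, and existence of an optimal cover *)

Lemma opt_independent Ps Cs x0 : opt Ps Cs -> exists S : {set V}, [/\ S \subset X,
  (forall w w', w \in S -> w' \in S -> w != w' -> ~~ conf w w') &
  size Ps + size Cs <= #|S|].
Proof.
move=> op; have [f fP] : exists f : V -> V * V, forall s,
    s \in bent Ps Cs -> deep Ps Cs s (f s).1 (f s).2.
  apply: (fin_all_exists (P := fun s (p : V * V) => _ -> deep Ps Cs s p.1 p.2)) => s.
  case: (boolP (s \in bent Ps Cs)) => sb; last by exists (s, s).
  by move: sb; rewrite inE => /andP [_ /existsP [u /existsP [x d]]]; exists (u, x).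
have [G GP] : exists G : V -> V -> V, forall s, guide Ps Cs s (G s).
  exact: (fin_all_exists (guide_exists op)).
have [pk pkP] := fin_all_exists (pick_exists op fP GP).
(* The default [x0] is not reached on the cycles concerned, by [cyc_free]. *)
pose xc (C : seq V) := odflt x0 [pick x | (x \in X) && (x \in C) && (nbr e x \subset C)].
apply: (independent_exists op fP GP pkP (xc := xc)) => C CCs sC; rewrite /xc.
case: pickP => [x /andP [/andP [? ?] ?] //|none].
have [x [xC xX sub]] := cyc_free op CCs sC.
by have := none x; rewrite xC xX sub.
Qed.

Lemma sqs_bound Ps Cs : cov Ps Cs -> sqs Ps <= size Ps * (#|V| * #|V|).
Proof.
move=> cv; have : {in Ps, forall P, size P <= #|V|}.
  by move=> P PPs; have /card_uniqP <- := cov_uniqP cv PPs; apply: max_card.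
elim: Ps {cv} => // P Ps IH H; rewrite /sqs /= -/(sqs Ps) mulSn leq_add //.
  by rewrite leq_mul // H ?mem_head.
by apply: IH => Q QPs; apply: H; rewrite inE QPs orbT.
Qed.

Lemma cov_singletons : cov [seq [:: x] | x <- enum X] [::].
Proof.
have fE : cells [seq [:: x] | x <- enum X] [::] = enum X.
  by rewrite /cells cats0; exact: flatten_seq1.
split => //; rewrite ?fE ?enum_uniq //.
- by apply/allP => P /mapP [x]; rewrite mem_enum => xX ->; exact: xpath1.
- by move=> x xX; rewrite mem_enum.
Qed.

End PathCovers.

(** The predicate is to quantify over covers and comes with no decision procedure, so the descent
    uses excluded middle. *)
Lemma least (P : nat -> Prop) : (exists n, P n) ->
  exists2 n, P n & forall m, P m -> n <= m.
Proof.
move=> [n Pn]; elim/ltn_ind: n Pn => n IH Pn.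
have [[m [Pm mn]]|H] := classic (exists m, P m /\ m < n); first exact: (IH m).
by exists n => // m Pm; rewrite leqNgt; apply/negP => mn; case: H; exists m.
Qed.

Lemma optimal_cover (V : finType) (e : rel V) (X : {set V}) : symmetric e ->
  (forall u v, e u v -> (u \in X) = (v \notin X)) -> exists p0 q0 s0 Ps Cs,
  [/\ forall Ps Cs, cov e X Ps Cs -> p0 <= size Ps + size Cs,
      forall Ps Cs, cov e X Ps Cs -> size Ps + size Cs = p0 -> q0 <= size Ps,
      forall Ps Cs, tight e X p0 q0 Ps Cs -> sqs Ps <= s0 &
      opt e X p0 q0 s0 Ps Cs].
Proof.
move=> e_sym eX.
have [p0 [Ps1 [Cs1 [cv1 sz1]]] p0_min] := least (P := fun p => exists Ps Cs,
  cov e X Ps Cs /\ size Ps + size Cs = p)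
  (ex_intro _ _ (ex_intro _ _ (ex_intro _ _ (conj (cov_singletons e X) erefl)))).
have [q0 [Ps2 [Cs2 [cv2 sz2 qE2]]] q0_min] := least (P := fun q => exists Ps Cs,
  [/\ cov e X Ps Cs, size Ps + size Cs = p0 & size Ps = q])
  (ex_intro _ _ (ex_intro _ _ (ex_intro _ _ (And3 cv1 sz1 erefl)))).
(* The sum of squares is maximised by minimising its distance to the bound [B]; the truncated
   subtraction is exact as no tight cover exceeds [B]. *)
pose B := q0 * (#|V| * #|V|).
have bound Ps Cs : tight e X p0 q0 Ps Cs -> sqs Ps <= B.
  by case=> cv _ qE; rewrite /B -qE; apply: sqs_bound cv.
have [k [Ps [Cs [tg kE]]] k_min] := least (P := fun k => exists Ps Cs,
  tight e X p0 q0 Ps Cs /\ B - sqs Ps = k)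
  (ex_intro _ _ (ex_intro _ _ (ex_intro _ _ (conj (And3 cv2 sz2 qE2) erefl)))).
exists p0, q0, (sqs Ps), Ps, Cs; split.
- by move=> Ps' Cs' cv; apply: p0_min; exists Ps', Cs'.
- by move=> Ps' Cs' cv sz; apply: q0_min; exists Ps', Cs'.
- move=> Ps' Cs' tg'; have : k <= B - sqs Ps' by apply: k_min; exists Ps', Cs'.
  by have := bound _ _ tg'; have := bound _ _ tg; move: kE; clear; lia.
- by split.
Qed.

Lemma flatten_disjoint (V : finType) (Rs : seq (seq V)) : uniq (flatten Rs) ->
  pairwise (fun p q : seq V => [disjoint p & q]) Rs.
Proof.
elim: Rs => //= p Rs IH; rewrite cat_uniq => /and3P [_ /hasPn pR /IH ->].
rewrite andbT; apply/allP => q qR; rewrite disjoint_sym; apply/pred0P => z /=.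
by apply/negP => /andP [zq /= zp]; have /pR : z \in flatten Rs; [apply/flattenP; exists q|rewrite zp].
Qed.

Theorem theorem4 (V : finType) (e : rel V) (X Y : {set V})
    (hG : bigraph e X Y) (hreg : regular e 3) :
  exists P : seq (seq V),
    path_cover e X P /\ size P <= alpha_Lambda e X Y.
Proof.
have [e_sym _ XYT XYd XYe] := hG.
case: (set_0Vmem X) => [->|[x0 _]].
  by exists [::]; split => //; split => // x; rewrite inE.
have eX u v : e u v -> (u \in X) = (v \notin X).
  have nY x : x \in Y -> (x \in X) = false by exact: (disjointFl XYd).
  by move=> /XYe /orP [] /andP [h1 h2]; rewrite ?h1 ?h2 nY.
have [p0 [q0 [s0 [Ps [Cs [p0_min q0_min s0_max op]]]]]] := optimal_cover e_sym eX.
have [S [SX Sn Sz]] := opt_independent e_sym eX p0_min q0_min s0_max hreg x0 op.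
have [[cv _ _] _] := op; have [/allP xP /allP xC un sub] := cv.
(* The sequence of a cycle, read without its closing edge, is a path. *)
exists (Ps ++ Cs); split; last first.
  rewrite size_cat; apply: leq_trans Sz _; apply: (leq_bigmax_cond S).
  rewrite /Lambda_independent SX /=; apply/eqP/setP => y; rewrite !inE.
  apply/negP => /andP [_ /card_gt1P [w [w' [+ + ww]]]].
  rewrite !inE => /andP [yw wS] /andP [yw' wS'].
  case/negP: (Sn w w' wS wS' ww); apply/existsP; exists y.
  by rewrite ![e _ y]e_sym yw.
split.
- rewrite all_cat; apply/andP; split; apply/allP => P PR.
    have := cov_uniqP cv PR; have := xP P PR.
    by case: P {PR} => // x p /and3P [_ pp _] up; rewrite /gpath pp.
  have := cov_uniqC cv PR; have := xC P PR.
  by case: P {PR} => // x p /andP [/= + _] up; rewrite rcons_path => /andP [->].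
- by apply: flatten_disjoint; rewrite flatten_cat.
- move=> x /sub; rewrite /cells -flatten_cat => /flattenP [P PR xp].
  by exists P.
Qed.
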